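(* Let $a<b$ be real numbers, $n\ge 1$, and let $\mathcal{R}=R(\frac{\partial}{\partial z})=\begin{pmatrix}\mathcal{P}\\ \mathcal{S}\end{pmatrix}$ be a maximally reciprocal constant-coefficient $2n\times n$ matrix differential operator of order $M$. Let $R_\partial(s)=\begin{pmatrix}P_\partial(s)\\ S_\partial(s)\end{pmatrix}$ be the boundary polynomial matrix of $\mathcal{R}$ (with $P_\partial,S_\partial$ of size $p\times n$). Consider the extended space $\mathcal{C}=L^2([a,b],\mathbb{R}^n)^2\times\mathbb{R}^{2p}\times\mathbb{R}^{2p}$, with elements $c=(x,e,\chi_\partial,\varepsilon_\partial)$, where $\chi_\partial=(\chi_\partial(a),\chi_\partial(b))$, $\varepsilon_\partial=(\varepsilon_\partial(a),\varepsilon_\partial(b))$ and each component lies in $\mathbb{R}^p$. Then the subspace $$\mathcal{L}_{\mathcal{R}}=\Big\{(x,e,\chi_\partial,\varepsilon_\partial)\in\mathcal{C}\ :\ \exists\,\xi\in H^M([a,b],\mathbb{R}^n)\ \text{s.t.}\ \begin{pmatrix}x\\ e\end{pmatrix}=\mathcal{R}\,\xi,\ \ \begin{pmatrix}\chi_\partial\\ \varepsilon_\partial\end{pmatrix}=\mathrm{tr}\left(\begin{pmatrix}P_\partial(\frac{\partial}{\partial z})\\ S_\partial(\frac{\partial}{\partial z})\end{pmatrix}\xi\right)\Big\}$$ is a Lagrangian subspace of $\mathcal{C}$ with respect to the alternate product $$\llbracket c_1,c_2\rrbracket=\int_a^b\big(e_1^\top x_2-e_2^\top x_1\big)\,dz-\Big[\varepsilon_{\partial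 1}^\top\chi_{\partial 2}-\chi_{\partial 1}^\top\varepsilon_{\partial 2}\Big]_a^b ,\qquad c_i=(x_i,e_i,\chi_{\partial i},\varepsilon_{\partial i}),$$ that is, $\mathcal{L}_{\mathcal{R}}$ equals its own orthogonal complement with respect to $\llbracket\cdot,\cdot\rrbracket$.
   Context: Operators: $\mathcal{R}=\sum_{i=0}^M R_i\frac{\partial^i}{\partial z^i}$ with constant $R_i\in\mathbb{R}^{2n\times n}$, with polynomial matrix $R(s)=\sum_i R_is^i=\begin{pmatrix}P(s)\\ S(s)\end{pmatrix}$, where $P,S$ are $n\times n$; $\mathcal{P}=P(\frac{\partial}{\partial z})$, $\mathcal{S}=S(\frac{\partial}{\partial z})$. The formal adjoint of $A(\frac{\partial}{\partial z})=\sum_k A_k\frac{\partial^k}{\partial z^k}$ is $A^*=\sum_k(-1)^kA_k^\top\frac{\partial^k}{\partial z^k}$. $\Theta_m=\begin{pmatrix}0_m&-I_m\\ I_m&0_m\end{pmatrix}$. Maximally reciprocal: $\mathcal{R}$ is reciprocal if $\mathcal{S}^*\mathcal{P}-\mathcal{P}^*\mathcal{S}=\mathcal{R}^*\Theta_n\mathcal{R}=0$ (equivalently $S^\top(-s)P(s)-P^\top(-s)S(s)=0$ identically in $s$). It is maximally reciprocal if moreover it satisfies the maximality condition $\operatorname{Im}\mathcal{R}=\ker\mathcal{R}^*\Theta_n$; equivalently, $\operatorname{rank}R(s)=n$ for all $s\in\mathbb{C}$. Boundary polynomial matrix: let $\bar\Phi(\zeta,\eta)=R^\top(\zeta)\Theta_nR(\eta)=S^\top(\zeta)P(\eta)-P^\top(\zeta)S(\eta)$.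 By reciprocity $\bar\Phi(\zeta,\eta)=(\zeta+\eta)\bar\Psi(\zeta,\eta)$ for a unique two-variable polynomial matrix $\bar\Psi$. The boundary polynomial matrix of $\mathcal{R}$ is a $2p\times n$ polynomial matrix $R_\partial(s)=\sum_k R_{\partial,k}s^k$ whose coefficient matrix $[R_{\partial,0}\ R_{\partial,1}\ \cdots]$ has full row rank and which satisfies $\bar\Psi(\zeta,\eta)=R_\partial^\top(\zeta)\Theta_pR_\partial(\eta)$. It is split into two $p\times n$ blocks $P_\partial,S_\partial$. Trace and brackets: $\mathrm{tr}(\varphi)=\begin{pmatrix}\varphi(a)\\ \varphi(b)\end{pmatrix}$, so that $\chi_\partial(z)=(P_\partial(\frac{\partial}{\partial z})\xi)(z)$ and $\varepsilon_\partial(z)=(S_\partial(\frac{\partial}{\partial z})\xi)(z)$ for $z\in\{a,b\}$; $[g]_a^b=g(b)-g(a)$. $H^M$ is the usual Sobolev space. The orthogonal complement of $\mathcal{L}\subset\mathcal{C}$ is $\{c\in\mathcal{C}:\llbracket c',c\rrbracket=0\ \forall c'\in\mathcal{L}\}$.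
   Formalization: Maximality Im R = ker R*Θ_n is taken for R: H^M→L² with R*Θ_n in the distribution sense; this adds full rank of the top coefficient R_M to rank R(s)=n for all s. The rank condition alone is not enough: for P=I, S=diag(s²,1), L_R is not closed. *)

(* Defs.v *)
From HB Require Import structures.
From mathcomp Require Import all_boot all_order all_algebra.
From mathcomp Require Import all_classical all_reals all_analysis.

Set Implicit Arguments.
Unset Strict Implicit.
Unset Printing Implicit Defensive.

Import Order.TTheory GRing.Theory Num.Theory.
Import numFieldNormedType.Exports.

Local Open Scope classical_set_scope.
Local Open Scope ring_scope.

Section PolynomialMatrices.
Variable K : realType.

(* 1 + the degree of A; 0 when A = 0. *)
Definition mxsize m n (A : 'M[{poly K}]_(m, n)) : nat :=
  \max_(i < m) \max_(j < n) size (A i j).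

Definition coefmx m n (k : nat) (A : 'M[{poly K}]_(m, n)) : 'M[K]_(m, n) :=
  map_mx (fun q : {poly K} => q`_k) A.

(* A^T(-s) *)
Definition formal_adjoint m n (A : 'M[{poly K}]_(m, n)) : 'M[{poly K}]_(n, m) :=
  map_mx (fun q => q \Po (- 'X)) A^T.

Definition Theta (S : nzRingType) (m : nat) : 'M[S]_(m + m) :=
  block_mx 0 (- 1%:M) 1%:M 0.

Definition reciprocal n (R : 'M[{poly K}]_(n + n, n)) : Prop :=
  formal_adjoint (dsubmx R) *m usubmx R
    - formal_adjoint (usubmx R) *m dsubmx R = 0.

(* Two-variable polynomials are {poly {poly K}}: zeta is the inner variable and
   eta the outer one. *)
Definition at_zeta m n (A : 'M[{poly K}]_(m, n)) : 'M[{poly {poly K}}]_(m, n) :=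
  map_mx polyC A.

Definition at_eta m n (A : 'M[{poly K}]_(m, n)) : 'M[{poly {poly K}}]_(m, n) :=
  map_mx (map_poly polyC) A.

Definition zeta_plus_eta : {poly {poly K}} := 'X%:P + 'X.

Definition theta_form m n (A : 'M[{poly K}]_(m + m, n)) :
    'M[{poly {poly K}}]_n :=
  (at_zeta A)^T *m Theta _ m *m at_eta A.

Definition boundary_polynomial_matrix n p
    (R : 'M[{poly K}]_(n + n, n)) (Rb : 'M[{poly K}]_(p + p, n)) : Prop :=
  row_free (\mxrow_(k < mxsize Rb) coefmx k Rb) /\
  exists2 Psi : 'M[{poly {poly K}}]_n,
    theta_form R = zeta_plus_eta *: Psi & Psi = theta_form Rb.

End PolynomialMatrices.

Section SobolevSpaces.
Variables (K : realType) (a b : K).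

Let J : set K := `[a, b].

Let mu : {measure set (measurableTypeR K) -> \bar K} := @lebesgue_measure K.

Definition component m (f : K -> 'cV[K]_m) (i : 'I_m) : K -> K := fun z => f z i 0.

Definition dot m (u v : 'cV[K]_m) : K := (u^T *m v) 0 0.

(* Elements of L^2 are handled through representatives; all the subsets of L^2
   considered below are stable under equality almost everywhere on [a, b]. *)
Definition in_L2 (f : K -> K) : Prop :=
  measurable_fun J f /\
  mu.-integrable J (fun z => (f z ^+ 2)%:E).

Definition in_L2v m (f : K -> 'cV[K]_m) : Prop := forall i, in_L2 (component f i).

Definition eq_aev m (f g : K -> 'cV[K]_m) : Prop := f = g %[ae mu in J].

Definition supported_inside (phi : K -> K) : Prop :=
  exists c d : K, [/\ a < c, d < b & forall z, phi z != 0 -> c <= z <= d].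

Definition test_C1 (phi : K -> K) : Prop :=
  [/\ forall z, derivable phi z 1, continuous (derive1 phi) & supported_inside phi].

Definition test_smooth (phi : K -> K) : Prop :=
  (forall k z, derivable (derive1n k phi) z 1) /\ supported_inside phi.

(* In dimension one, C^1 test functions suffice to define the weak derivative,
   and H^(m+1) consists of the functions of L^2 with weak derivative in H^m. *)
Definition weak_derivative (f g : K -> K) : Prop :=
  forall phi, test_C1 phi ->
    (\int[mu]_(z in J) (f z * derive1 phi z) =
     - \int[mu]_(z in J) (g z * phi z))%R.

Fixpoint sobolev (m : nat) (f : K -> K) : Prop :=
  if m is m'.+1
  then in_L2 f /\ exists2 g, weak_derivative f g & sobolev m' g
  else in_L2 f.

Definition sobolevv (m n : nat) (f : K -> 'cV[K]_n) : Prop :=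
  forall i, sobolev m (component f i).

(* A choice of the weak derivative, which is unique almost everywhere. *)
Definition wderive (f : K -> K) : K -> K :=
  xget (cst 0) [set g | in_L2 g /\ weak_derivative f g].

(* A(d/dz) xi, where der is the derivation: wderive on Sobolev functions and
   derive1 on smooth functions. *)
Definition diffop (der : (K -> K) -> (K -> K)) m n
    (A : 'M[{poly K}]_(m, n)) (xi : K -> 'cV[K]_n) : K -> 'cV[K]_m :=
  fun z => \sum_(k < mxsize A)
    coefmx k A *m \col_i iter k der (component xi i) z.

(* A(d/dz) w = 0 on ]a, b[ in the sense of distributions. *)
Definition distr_ker m n (A : 'M[{poly K}]_(m, n)) (w : K -> 'cV[K]_n) : Prop :=
  forall phi : K -> 'cV[K]_m, (forall i, test_smooth (component phi i)) ->
    (\int[mu]_(z in J)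
       dot (w z) (diffop (@derive1 K K) (formal_adjoint A) phi z) = 0)%R.

(* Im R = ker (R^* Theta_n) in L^2([a, b]), for R as an operator from
   H^M([a, b]) to L^2([a, b]) and R^* Theta_n acting on L^2 in the sense of
   distributions.  On these spaces the equality is stronger than
   rank R(s) = n for all complex s: it holds iff, moreover, the coefficient R_M
   of the top degree M has rank n.  The rank condition over the complex numbers
   is not enough for LR below to be Lagrangian: for the blocks P = I and
   S = diag(s^2, 1), M = 2, the second components (x_2, e_2) = (xi_2, xi_2),
   xi_2 in H^2, do not form a closed subspace of L^2. *)
Definition maximal (M n : nat) (R : 'M[{poly K}]_(n + n, n)) : Prop :=
  forall w : K -> 'cV[K]_(n + n), in_L2v w ->
    ((exists2 xi : K -> 'cV[K]_n,
        sobolevv M xi & eq_aev w (diffop wderive R xi)) <->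
     distr_ker (formal_adjoint R *m Theta _ n) w).

Definition maximally_reciprocal (M n : nat) (R : 'M[{poly K}]_(n + n, n)) :
    Prop :=
  reciprocal R /\ maximal M R.

(* t is the value at z of the continuous representative of f. *)
Definition is_trace (f : K -> K) (z t : K) : Prop :=
  exists g : K -> K,
    [/\ {within J, continuous g}, f = g %[ae mu in J]
      & g z = t].

Definition is_tracev m (f : K -> 'cV[K]_m) (z : K) (t : 'cV[K]_m) : Prop :=
  forall i, is_trace (component f i) z (t i 0).

(* The boundary components are the pairs of their values at a and at b. *)
Record ext (n p : nat) := Ext {
  ext_x : K -> 'cV[K]_n;
  ext_e : K -> 'cV[K]_n;
  ext_chi : 'cV[K]_p * 'cV[K]_p;
  ext_eps : 'cV[K]_p * 'cV[K]_p }.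

Definition extended_space (n p : nat) : set (ext n p) :=
  [set c | in_L2v (ext_x c) /\ in_L2v (ext_e c)].

Definition alternate_product n p (c1 c2 : ext n p) : K :=
  (\int[mu]_(z in J)
     (dot (ext_e c1 z) (ext_x c2 z) - dot (ext_e c2 z) (ext_x c1 z)))%R
  - ((dot (ext_eps c1).2 (ext_chi c2).2 - dot (ext_chi c1).2 (ext_eps c2).2)
     - (dot (ext_eps c1).1 (ext_chi c2).1
        - dot (ext_chi c1).1 (ext_eps c2).1)).

Definition orthogonal_complement n p (L : set (ext n p)) : set (ext n p) :=
  [set c | extended_space c /\ forall c', L c' -> alternate_product c' c = 0].

Definition Lagrangian n p (L : set (ext n p)) : Prop :=
  L = orthogonal_complement L.

Definition LR (M n p : nat) (R : 'M[{poly K}]_(n + n, n))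
    (Rb : 'M[{poly K}]_(p + p, n)) : set (ext n p) :=
  [set c | extended_space c /\
    exists xi : K -> 'cV[K]_n,
      [/\ sobolevv M xi,
          eq_aev (fun z => col_mx (ext_x c z) (ext_e c z))
                 (diffop wderive R xi),
          is_tracev (diffop wderive Rb xi) a
            (col_mx (ext_chi c).1 (ext_eps c).1)
        & is_tracev (diffop wderive Rb xi) b
            (col_mx (ext_chi c).2 (ext_eps c).2)]].

End SobolevSpaces.

(* Main.v *)
Require Import Defs.
From mathcomp Require Import all_boot all_order all_algebra.
From mathcomp Require Import all_classical all_reals all_analysis.
From mathcomp Require Import measurable_realfun.
From mathcomp Require Import ring lra.

(** The pairing is governed by the Green identity
    [int (R xi)^T Theta (R eta) = [(Rb xi)^T Theta (Rb eta)]_a^b], which is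
    integration by parts for absolutely continuous functions applied to
    [theta_form R = (zeta + eta) theta_form Rb]; it makes LR isotropic.
    Conversely, let c be orthogonal to LR.  Testing against the elements of LR
    generated by test functions, whose traces vanish, shows that (x, e) is
    annihilated by [R^* Theta] in the sense of distributions, so (x, e) = R xi by
    maximality.  The Green identity then says that the boundary components of c
    minus the traces of [Rb xi] are orthogonal to all traces, and these exhaust
    the boundary space: the coefficient matrix of Rb has full row rank, and
    Hermite interpolation prescribes jets at a and at b independently. *)

Set Implicit Arguments.
Unset Strict Implicit.
Unset Printing Implicit Defensive.

Import Order.TTheory GRing.Theory Num.Theory.
Import numFieldNormedType.Exports.

Local Open Scope classical_set_scope.
Local Open Scope ring_scope.

(** * Square-integrable functions and primitives *)

Section L2.
Variables (K : realType) (a b : K).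
Local Notation mu := (@lebesgue_measure K).
Local Notation J := `[a, b]%classic.
Implicit Types f g : K -> K.

(** Regularity is the delicate point. [wderive] picks a weak derivative, determined only almost
    everywhere, whereas traces are values at single points. Jets reconcile the two: for xi in H^M
    every derivative of order k < M has an absolutely continuous representative, while the
    derivative of order M is merely square-integrable. Boundary terms may therefore involve orders
    below M only, and it is the full row rank of the coefficients of [Rb] that excludes higher ones.
    Integration by parts has to work with derivatives that are only in L^2, so it comes from Fubini
    on a triangle instead of a pointwise product rule. That a function with an L^2 weak derivative
    has an absolutely continuous representative is the du Bois-Reymond lemma, tested with explicit
    C^1 splines. On the algebraic side, multiplication by zeta + eta is the Leibniz rule: zeta
    differentiates the left argument of the bilinear form and eta the right one. *)

Lemma in_L2_integrable f : in_L2 a b f -> mu.-integrable J (EFin \o f).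
Proof.
case=> mf if2.
have mJ : measurable (J : set (measurableTypeR K)) by exact: measurable_itv.
have i1 : mu.-integrable J (EFin \o (fun z => 1 + f z ^+ 2)).
  rewrite [X in mu.-integrable _ X](_ : _ = (EFin \o cst 1) \+ (fun z => (f z ^+ 2)%:E)) //.
  apply: integrableD => //.
  apply: continuous_compact_integrable; first exact: segment_compact.
  by move=> x; exact: cvg_cst.
apply: le_integrable i1 => //.
  exact/measurable_EFinP.
move=> x _ /=; rewrite lee_fin.
rewrite (@ger0_norm _ (1 + _)); last by rewrite addr_ge0// sqr_ge0.
rewrite -(real_normK (num_real (f x))).
set y := `|f x|; have : 0 <= y by rewrite normr_ge0.
nra.
Qed.

Lemma in_L2M_integrable f g : in_L2 a b f -> in_L2 a b g ->
  mu.-integrable J (EFin \o (fun z => f z * g z)).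
Proof.
move=> [mf if2] [mg ig2].
have mJ : measurable (J : set (measurableTypeR K)) by exact: measurable_itv.
have := integrableD mJ if2 ig2.
apply: le_integrable => //.
  by apply/measurable_EFinP; exact: measurable_funM.
move=> x _ /=; rewrite lee_fin.
rewrite (@ger0_norm _ (_ + _)); last by rewrite addr_ge0// sqr_ge0.
rewrite -(real_normK (num_real (f x))) -(real_normK (num_real (g x))) normrM.
have := normr_ge0 (f x); have := normr_ge0 (g x).
have := sqr_ge0 (`|f x| - `|g x|). nra.
Qed.

Lemma in_L2D f g : in_L2 a b f -> in_L2 a b g -> in_L2 a b (fun z => f z + g z).
Proof.
move=> Lf Lg; have := in_L2M_integrable Lf Lg.
case: Lf => mf if2; case: Lg => mg ig2 ifg; split; first exact: measurable_funD.
have mJ : measurable (J : set (measurableTypeR K)) by exact: measurable_itv.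
have := integrableD mJ (integrableD mJ if2 ig2) (integrableD mJ ifg ifg).
apply: eq_integrable => // x _ /=; rewrite -!EFinD; congr EFin; ring.
Qed.

Lemma in_L2Z c f : in_L2 a b f -> in_L2 a b (fun z => c * f z).
Proof.
case=> mf if2; split; first exact: measurable_funM.
have mJ : measurable (J : set (measurableTypeR K)) by exact: measurable_itv.
have := integrableZl mJ (c ^+ 2) if2.
by apply: eq_integrable => // x _ /=; rewrite -EFinM exprMn.
Qed.

Lemma continuous_in_L2 f : {within J, continuous f} -> in_L2 a b f.
Proof.
move=> cf; split.
  exact: subspace_continuous_measurable_fun.
apply: continuous_compact_integrable; first exact: segment_compact.
have -> : (fun z => f z ^+ 2) = f \* f by apply/funext => z; rewrite /= expr2.
by move=> x; apply: cvgM; apply: cf.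
Qed.

Lemma in_L2_sum (I : Type) (s : seq I) (F : I -> K -> K) :
  (forall i, in_L2 a b (F i)) -> in_L2 a b (fun z => \sum_(i <- s) F i z).
Proof.
move=> LF; elim: s => [|i s IH].
  rewrite (_ : (fun _ => _) = cst 0); last by apply/funext => z; rewrite big_nil.
  by apply: continuous_in_L2 => x; exact: cvg_cst.
rewrite (_ : (fun _ => _) = (fun z => F i z + \sum_(i <- s) F i z)).
  exact: in_L2D.
by apply/funext => z; rewrite big_cons.
Qed.

End L2.

(** * Exchange of iterated integrals over a triangle *)

Section IteratedIntegrals.
Variables (K : realType) (a b : K).
Local Notation mu := (@lebesgue_measure K).
Local Notation J := `[a, b]%classic.
Implicit Types f g h u v : K -> K.

(** Moves the variable endpoint into the kernel 1_{y <= x}, so that an iterated integral over a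
    triangle becomes one over the whole plane, where Fubini applies. *)
Lemma integral_patch_le f x : x \in `[a, b] ->
  (\int[mu]_(y in `[a, x]) (f y)%:E =
   \int[mu]_y ((f \_ J) y * (y <= x)%R%:R)%:E)%E.
Proof.
rewrite in_itv/= => /andP[ax xb]; rewrite [LHS]integral_mkcond.
apply: eq_integral => y _; rewrite !patchE.
have [yx|yx] := leP y x; rewrite ?mulr1 ?mulr0; last first.
  by rewrite ifF//; apply/negP; rewrite inE /= in_itv/= (leNgt y x) yx andbF.
have [ay|ay] := leP a y; last first.
  by rewrite !ifF//; apply/negP; rewrite inE /= in_itv/= (leNgt a y) ay.
by rewrite !ifT// inE /= in_itv/= ay// (le_trans yx xb).
Qed.

Lemma integral_patch_ge f y : y \in `[a, b] ->
  (\int[mu]_(x in `[y, b]) (f x)%:E =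
   \int[mu]_x ((f \_ J) x * (y <= x)%R%:R)%:E)%E.
Proof.
rewrite in_itv/= => /andP[ay yb]; rewrite [LHS]integral_mkcond.
apply: eq_integral => x _; rewrite !patchE.
have [yx|yx] := leP y x; rewrite ?mulr1 ?mulr0; last first.
  by rewrite ifF//; apply/negP; rewrite inE /= in_itv/= (leNgt y x) yx.
have [xb|xb] := leP x b; last first.
  by rewrite !ifF//; apply/negP; rewrite inE /= in_itv/= (leNgt x b) xb andbF.
by rewrite !ifT// inE /= in_itv/= xb ?yx// (le_trans ay yx).
Qed.

Lemma integrable_subitv f c d : a <= c -> d <= b -> mu.-integrable J (EFin \o f) ->
  mu.-integrable `[c, d] (EFin \o f).
Proof.
move=> ac db; apply: integrableS => // x /=; rewrite !in_itv/= => /andP[cx xd].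
by rewrite (le_trans ac cx) (le_trans xd db).
Qed.

(** Fubini for the function f(x) g(y) on the triangle a <= y <= x <= b, sliced in the two
    directions. *)
Lemma Rintegral_swap f g :
  mu.-integrable J (EFin \o f) -> mu.-integrable J (EFin \o g) ->
  \int[mu]_(x in J) (f x * \int[mu]_(y in `[a, x]) g y) =
  \int[mu]_(y in J) (g y * \int[mu]_(x in `[y, b]) f x).
Proof.
move=> If Ig.
have mJ : measurable (J : set (measurableTypeR K)) by exact: measurable_itv.
have le1 (c : bool) : `|c%:R : K| <= 1 by case: c; rewrite ?normr1 ?normr0.
pose F (z : K * K) : \bar K := ((f \_ J) z.1 * ((g \_ J) z.2 * (z.2 <= z.1)%R%:R))%:E.
have IfT : mu.-integrable setT (EFin \o (f \_ J)).
  by rewrite -restrict_EFin; exact/(integrable_mkcond _ mJ).1.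
have IgT : mu.-integrable setT (EFin \o (g \_ J)).
  by rewrite -restrict_EFin; exact/(integrable_mkcond _ mJ).1.
have mfJ : measurable_fun setT (f \_ J).
  by apply/measurable_EFinP; exact: measurable_int IfT.
have mgJ : measurable_fun setT (g \_ J).
  by apply/measurable_EFinP; exact: measurable_int IgT.
have mle : measurable_fun setT (fun z : K * K => (z.2 <= z.1)%R%:R : K).
  apply: (measurableT_comp (f := fun b : bool => b%:R : K)) => //.
  exact: measurable_fun_ler.
have mF : measurable_fun setT F.
  apply/measurable_EFinP; apply: measurable_funM; first exact: measurableT_comp.
  by apply: measurable_funM => //; exact: measurableT_comp.
have Ig1 (x : K) : mu.-integrable setT (fun y => ((g \_ J) y * (y <= x)%R%:R)%:E).
  apply: le_integrable IgT => //.
    apply/measurable_EFinP; apply: measurable_funM => //.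
    apply: (measurableT_comp (f := fun b : bool => b%:R : K)) => //.
    exact: measurable_fun_ler.
  by move=> y _; rewrite lee_fin normrM ler_piMr ?le1.
have If1 (y : K) : mu.-integrable setT (fun x => ((f \_ J) x * (y <= x)%R%:R)%:E).
  apply: le_integrable IfT => //.
    apply/measurable_EFinP; apply: measurable_funM => //.
    apply: (measurableT_comp (f := fun b : bool => b%:R : K)) => //.
    exact: measurable_fun_ler.
  by move=> x _; rewrite lee_fin normrM ler_piMr ?le1.
have mFx (x : K) : measurable_fun setT (fun y => F (x, y)).
  apply/measurable_EFinP; apply: measurable_funM => //=.
  by apply/measurable_EFinP; exact: (measurable_int mu (Ig1 x)).
(* Tonelli: the kernel is at most 1, so [F] is dominated by |f(x)| |g(y)|, whose iterated integral
   is the product of the two L^1 norms. *)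
have iF : (mu \x mu)%E.-integrable setT F.
  apply/integrable12ltyP => //.
  apply: (@le_lt_trans _ _ (\int[mu]_x (`|(f \_ J) x|%:E * \int[mu]_y `|(g \_ J) y|%:E))%E).
    apply: ge0_le_integral => //.
    - by move=> x _; apply: integral_ge0.
    - apply: (@measurable_fun_fubini_tonelli_F _ _ (measurableTypeR K) (measurableTypeR K)
        K mu (fun z => `|F z|%E)) => //.
      exact: measurableT_comp.
    - apply: emeasurable_funM => //.
      by apply/measurable_EFinP; exact: measurableT_comp.
    move=> x _; rewrite -ge0_integralZl//=.
    - apply: ge0_le_integral => //.
      + apply/measurable_EFinP; apply: measurableT_comp => //.
        by apply/measurable_EFinP; exact: mFx.
      + by apply: measurable_funeM; apply/measurable_EFinP; exact: measurableT_comp.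
      + by move=> y _; rewrite -EFinM lee_fin !normrM ler_wpM2l// ler_piMr ?le1.
    - by apply/measurable_EFinP; exact: measurableT_comp.
  have /integrableP[_ gfin] := IgT.
  have /integrableP[_ ffin] := IfT.
  rewrite [X in (X < _)%E](_ : _ =
      (\int[mu]_x `|(f \_ J) x|%:E) * (\int[mu]_x `|(g \_ J) x|%:E))%E; last first.
    rewrite ge0_integralZr//; first by apply/measurable_EFinP; exact: measurableT_comp.
    by apply: integral_ge0.
  by apply: lte_mul_pinfty => //; [exact: integral_ge0|
    rewrite ge0_fin_numE//; exact: integral_ge0].
have := Fubini iF; rewrite /F /=.
under eq_integral do under eq_integral do rewrite EFinM.
under [X in _ = X -> _]eq_integral => y _ do under eq_integral => x _ do
  rewrite mulrCA EFinM.
under eq_integral => x _ do rewrite integralZl//.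
under [X in _ = X -> _]eq_integral => y _ do rewrite integralZl//.
rewrite /Rintegral [in X in _ -> X = _]integral_mkcond
  [in X in _ -> _ = X]integral_mkcond => H.
congr fine.
transitivity (\int[mu]_x (((f \_ J) x)%:E *
    \int[mu]_y ((g \_ J) y * (y <= x)%R%:R)%:E))%E.
  apply: eq_integral => x _; rewrite [in LHS]patchE.
  case: ifPn => [|/negbTE xJ]; last by rewrite patchE xJ mul0e.
  rewrite inE => xJ; rewrite EFinM -(integral_patch_le _ xJ) patchE mem_set//.
  congr (_ * _)%E; apply: fineK; apply: integrable_fin_num => //.
  move: xJ; rewrite /= in_itv/= => /andP[ax xb].
  exact: integrable_subitv Ig.
rewrite H; apply: eq_integral => y _; rewrite [in RHS]patchE.
case: ifPn => [|/negbTE yJ]; last by rewrite patchE yJ mul0e.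
rewrite inE => yJ; rewrite EFinM -(integral_patch_ge _ yJ) patchE mem_set//.
congr (_ * _)%E; apply/esym/fineK; apply: integrable_fin_num => //.
move: yJ; rewrite /= in_itv/= => /andP[ay yb].
exact: integrable_subitv If.
Qed.

End IteratedIntegrals.

(** * Absolutely continuous functions and integration by parts *)

Section Primitives.
Variables (K : realType) (a b : K).
Hypothesis hab : a < b.
Local Notation mu := (@lebesgue_measure K).
Local Notation J := `[a, b]%classic.
Implicit Types f g h u v : K -> K.

(** On [a, b], [u] is absolutely continuous with square-integrable derivative [g], that is, the
    continuous representative of an H^1 function. Its values outside [a, b] are left free. *)
Definition primitive u g : Prop :=
  in_L2 a b g /\ {in `[a, b], forall z, u z = u a + \int[mu]_(x in `[a, z]) g x}.

Lemma primitive_continuous u g : primitive u g -> {within J, continuous u}.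
Proof.
move=> [/in_L2_integrable Ig ug].
have cp := parameterized_integral_continuous (ltW hab) Ig.
apply: (@subspace_eq_continuous _ _ _ (fun z => u a + \int[mu]_(x in `[a, z]) g x)).
  by move=> z; rewrite inE => zJ; exact: (esym (ug z zJ)).
by move=> z; apply: cvgD; [exact: cvg_cst|exact: cp].
Qed.

Lemma primitive_in_L2 u g : primitive u g -> in_L2 a b u.
Proof. by move/primitive_continuous/continuous_in_L2. Qed.

(** Write u and v as initial value plus integral. After the exchange on the triangle, the integral
    of g over [y, b] is the total [G] minus the one over [a, y]; the double integrals cancel and
    leave (u a + G) (v a + H) - u a * v a. *)
Lemma primitive_by_parts u g v h : primitive u g -> primitive v h ->
  \int[mu]_(z in J) (g z * v z + u z * h z) = u b * v b - u a * v a.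
Proof.
move=> pu pv; have [Lu Lv] := (primitive_in_L2 pu, primitive_in_L2 pv).
case: pu pv => Lg ug [Lh vh].
have [Ig Ih] := (in_L2_integrable Lg, in_L2_integrable Lh).
have mJ : measurable (J : set (measurableTypeR K)) by exact: measurable_itv.
have bJ : b \in `[a, b] by rewrite in_itv/= lexx ltW.
rewrite RintegralD//; [|exact: in_L2M_integrable..].
set G := \int[mu]_(x in J) g x; set H := \int[mu]_(x in J) h x.
have LG : in_L2 a b (fun z => \int[mu]_(x in `[a, z]) g x).
  exact: continuous_in_L2 (parameterized_integral_continuous (ltW hab) Ig).
have LH : in_L2 a b (fun z => \int[mu]_(x in `[a, z]) h x).
  exact: continuous_in_L2 (parameterized_integral_continuous (ltW hab) Ih).
have -> : \int[mu]_(z in J) (g z * v z) =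
    v a * G + \int[mu]_(z in J) (g z * \int[mu]_(x in `[a, z]) h x).
  rewrite /G -RintegralZl// -RintegralD//; last 2 first.
  - exact: in_L2_integrable (in_L2Z _ Lg).
  - exact: in_L2M_integrable.
  by apply: eq_Rintegral => z; rewrite inE => zJ; rewrite vh// mulrDr mulrC.
have -> : \int[mu]_(z in J) (u z * h z) =
    u a * H + \int[mu]_(z in J) (h z * \int[mu]_(x in `[a, z]) g x).
  rewrite /H -RintegralZl// -RintegralD//; last 2 first.
  - exact: in_L2_integrable (in_L2Z _ Lh).
  - exact: in_L2M_integrable.
  by apply: eq_Rintegral => z; rewrite inE => zJ; rewrite ug// mulrDl; congr (_ + _); rewrite mulrC.
rewrite Rintegral_swap//.
have -> : \int[mu]_(y in J) (h y * \int[mu]_(x in `[y, b]) g x) =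
    G * H - \int[mu]_(y in J) (h y * \int[mu]_(x in `[a, y]) g x).
  rewrite /H -RintegralZl// -RintegralB//; last 2 first.
  - exact: in_L2_integrable (in_L2Z _ Lh).
  - exact: in_L2M_integrable.
  apply: eq_Rintegral => y; rewrite inE /= in_itv/= => /andP[ay yb].
  have Iyb : mu.-integrable `]y, b] (EFin \o g).
    apply: integrableS Ig => // x /=; rewrite !in_itv/= => /andP[/ltW yx ->].
    by rewrite (le_trans ay yx).
  rewrite -Rintegral_itv_obnd_cbnd// -(@Rintegral_itvB _ _ (BLeft a))//.
  by rewrite mulrBr mulrC.
rewrite (ug b)// (vh b)// -/G -/H; ring.
Qed.

Lemma derivable_primitive u : (forall z, derivable u z 1) ->
  continuous (derive1 u) -> primitive u (derive1 u).
Proof.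
move=> du cu; split.
  by apply: continuous_in_L2; exact: continuous_subspaceT.
move=> z; rewrite in_itv /= le_eqVlt => /andP[/predU1P[<- _|az _]].
  by rewrite set_itv1 Rintegral_set1 addr0.
have cdu (x : K) : {for x, continuous u}.
  exact/differentiable_continuous/derivable1_diffP.
have du_az : derivable_oo_LRcontinuous u a z.
  by split=> //; [apply: cvg_at_right_filter|apply: cvg_at_left_filter]; exact: cdu.
have := @continuous_FTC2 _ (derive1 u) u a z az (continuous_subspaceT cu) du_az
  (fun _ _ => erefl).
by rewrite /Rintegral => -> /=; rewrite addrCA subrr addr0.
Qed.

Lemma test_C1_primitive phi : test_C1 a b phi ->
  [/\ primitive phi (derive1 phi), phi a = 0 & phi b = 0].
Proof.
case=> dphi cphi [c [d [ac db phi0]]]; split; first exact: derivable_primitive.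
- by apply/eqP; apply: contraTT ac => /phi0/andP[ca _]; rewrite -leNgt.
- by apply/eqP; apply: contraTT db => /phi0/andP[_]; rewrite -leNgt.
Qed.

Lemma primitive_weak_derivative u g : primitive u g -> weak_derivative a b u g.
Proof.
move=> pu phi /test_C1_primitive[pphi pa pb].
have := primitive_by_parts pu pphi; rewrite pa pb !mulr0 subrr.
have mJ : measurable (J : set (measurableTypeR K)) by exact: measurable_itv.
rewrite RintegralD//.
- by move/eqP; rewrite addrC addr_eq0 => /eqP.
- by apply: in_L2M_integrable; [case: pu|exact: primitive_in_L2 pphi].
- by apply: in_L2M_integrable; [exact: primitive_in_L2 pu|case: pphi].
Qed.

End Primitives.

(** * The du Bois-Reymond lemma *)

Section Splines.
Variable K : realType.

(** Translates of z |z| are C^1 with piecewise linear derivative; their combinations give quadratic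
    splines in one closed formula, without gluing. *)
Lemma is_derive_mul_norm (x : K) : is_derive x 1 (fun z : K => z * `|z|) (2 * `|x|).
Proof.
have [x0|x0|->] := ltgtP x 0.
- apply: (@near_eq_is_derive K K^o K^o (fun z => - z ^+ 2)).
  + near=> z; rewrite ltr0_norm; first by rewrite mulrN expr2.
    by near: z; exact: lt_nbhsl.
  + by apply: is_derive_eq; rewrite ltr0_norm// ?scaler1 ?expr1 /GRing.scale /=; ring.
- apply: (@near_eq_is_derive K K^o K^o (fun z => z ^+ 2)).
  + near=> z; rewrite gtr0_norm; first by rewrite expr2.
    by near: z; exact: lt_nbhsr.
  + by apply: is_derive_eq; rewrite gtr0_norm// ?scaler1 ?expr1 /GRing.scale /=; ring.
(* At the kink the difference quotient is |z| itself, which is continuous. *)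
- apply/is_derive1_caratheodory; exists (fun z => `|z|); split.
  + by move=> z; rewrite mul0r !subr0 mulrC.
  + exact: norm_continuous.
  + by rewrite normr0 mulr0.
Unshelve. all: by end_near. Qed.

(* The derivative [dramp s t e] is the trapezoid which is 1 on [s + e, t - e]
   and 0 outside [s, t]. *)
Definition ramp (s t e z : K) : K :=
  ((z - s) * `|z - s| - (z - s - e) * `|z - s - e|
   - (z - t + e) * `|z - t + e| + (z - t) * `|z - t|) / (4 * e).

Definition dramp (s t e z : K) : K :=
  (`|z - s| - `|z - s - e| - `|z - t + e| + `|z - t|) / (2 * e).

Lemma is_derive_ramp (s t e x : K) : 0 < e ->
  is_derive x 1 (ramp s t e) (dramp s t e x).
Proof.
move=> e0.
have shift (c : K) : is_derive x 1 (fun z : K => (z - c) * `|z - c|) (2 * `|x - c|).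
  have d1 : is_derive x 1 (fun z : K => z - c) 1.
    by apply: is_derive_eq; rewrite subr0.
  have := @is_derive1_comp _ (fun z : K => z * `|z|) (fun z => z - c) x _ _
    (is_derive_mul_norm _) d1.
  by rewrite mulr1.
rewrite /ramp.
have -> : (fun z : K => ((z - s) * `|z - s| - (z - s - e) * `|z - s - e|
   - (z - t + e) * `|z - t + e| + (z - t) * `|z - t|) / (4 * e)) =
   (4 * e)^-1 \*: ((fun z => (z - s) * `|z - s|) - (fun z => (z - (s + e)) * `|z - (s + e)|)
     - (fun z => (z - (t - e)) * `|z - (t - e)|) + (fun z => (z - t) * `|z - t|)).
  by apply/funext => z; rewrite !fctE /= mulrC !opprD !addrA opprK.
have s1 := shift s; have s2 := shift (s + e); have s3 := shift (t - e); have s4 := shift t.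
apply: is_derive_eq.
rewrite /dramp /GRing.scale /= !opprD !addrA opprK.
by field; rewrite lt0r_neq0.
Qed.

Lemma continuous_dramp (s t e : K) : continuous (dramp s t e).
Proof.
move=> x; rewrite /dramp; apply: cvgM; last exact: cvg_cst.
have cn (c : K) : (fun z : K => `|z - c|) z @[z --> x] --> `|x - c|.
  by apply: cvg_norm; apply: cvgB; [exact: cvg_id|exact: cvg_cst].
have cn2 (c d : K) : (fun z : K => `|z - c + d|) z @[z --> x] --> `|x - c + d|.
  apply: cvg_norm; apply: cvgD; last exact: cvg_cst.
  by apply: cvgB; [exact: cvg_id|exact: cvg_cst].
apply: cvgD; last exact: cn.
by apply: cvgB; [apply: cvgB; [exact: cn|exact: cn2]|exact: cn2].
Qed.

Lemma ramp_lt (s t e z : K) : 0 < e -> e < t - s -> z <= s -> ramp s t e z = (s - t + e) / 2.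
Proof.
move=> e0 et zs; rewrite /ramp !ler0_norm; [|lra..].
by field; rewrite lt0r_neq0.
Qed.

Lemma ramp_gt (s t e z : K) : 0 < e -> e < t - s -> t <= z -> ramp s t e z = (t - s - e) / 2.
Proof.
move=> e0 et zs; rewrite /ramp !ger0_norm; [|lra..].
by field; rewrite lt0r_neq0.
Qed.

Lemma dramp_bound (s t e z : K) : 0 < e -> `|dramp s t e z| <= 1.
Proof.
move=> e0; rewrite /dramp normrM normfV (gtr0_norm (_ : 0 < 2 * e)); last lra.
rewrite ler_pdivrMr; last lra.
have h1 : `| `|z - s| - `|z - s - e| | <= e.
  by apply: le_trans (ler_dist_dist _ _) _; rewrite opprB addrCA subrr addr0 gtr0_norm.
have h2 : `| `|z - t| - `|z - t + e| | <= e.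
  apply: le_trans (ler_dist_dist _ _) _.
  by rewrite opprD addrA subrr add0r normrN gtr0_norm.
by move: h1 h2; rewrite !ler_norml => /andP[? ?] /andP[? ?]; apply/andP; split; lra.
Qed.

Lemma dramp_in (s t e z : K) : 0 < e -> s + e < z -> z < t - e -> dramp s t e z = 1.
Proof.
move=> e0 sz zt; rewrite /dramp (@ger0_norm _ (z - s)); last lra.
rewrite (@ger0_norm _ (z - s - e)); last lra.
rewrite (@ler0_norm _ (z - t + e)); last lra.
rewrite (@ler0_norm _ (z - t)); last lra.
by field; rewrite lt0r_neq0.
Qed.

Lemma dramp_out (s t e z : K) : 0 < e -> e < t - s -> z <= s \/ t <= z -> dramp s t e z = 0.
Proof.
move=> e0 et [zs|tz]; rewrite /dramp.
  by rewrite !ler0_norm; [field; rewrite lt0r_neq0|lra..].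
by rewrite !ger0_norm; [field; rewrite lt0r_neq0|lra..].
Qed.

(** A single ramp is not a test function, since it has distinct constant values on its two sides.
    These constants depend only on the length and on [e], so they cancel between two translates, and
    the difference is supported in [s, s' + L]. *)
Lemma test_C1_rampB (a b s s' L e : K) : a < s -> s <= s' -> s' + L < b -> 0 < e -> e < L ->
  test_C1 a b (fun z => ramp s (s + L) e z - ramp s' (s' + L) e z) /\
  derive1 (fun z => ramp s (s + L) e z - ramp s' (s' + L) e z) =
    (fun z => dramp s (s + L) e z - dramp s' (s' + L) e z).
Proof.
move=> as_ ss sb e0 eL.
have d (x : K) : is_derive x 1 (ramp s (s + L) e \- ramp s' (s' + L) e)
    (dramp s (s + L) e x - dramp s' (s' + L) e x).
  have ? := is_derive_ramp s (s + L) x e0; have ? := is_derive_ramp s' (s' + L) x e0.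
  exact: is_deriveB.
have dE : derive1 (fun z => ramp s (s + L) e z - ramp s' (s' + L) e z) =
    (fun z => dramp s (s + L) e z - dramp s' (s' + L) e z).
  by apply/funext => x; rewrite derive1E; case: (d x).
split=> //; split.
- by move=> z; case: (d z).
- by rewrite dE => z; apply: cvgB; exact: continuous_dramp.
- exists s, (s' + L); split=> // z; apply: contraNT.
  rewrite negb_and -!ltNge => /orP[zs|zs]; apply/eqP.
    rewrite (ramp_lt e0 _ (ltW zs)); last lra.
    by rewrite (ramp_lt e0 _ (le_trans (ltW zs) ss)); [field|lra].
  rewrite (ramp_gt e0 _ (ltW zs)); last lra.
  by rewrite (ramp_gt e0); [field|lra..].
Qed.

End Splines.

Section DuBoisReymond.
Variables (K : realType) (a b : K).
Hypothesis hab : a < b.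
Local Notation mu := (@lebesgue_measure K).
Local Notation J := `[a, b]%classic.
Implicit Types f g h u v : K -> K.

(** The denominator n + 2 keeps the width of the flanks strictly below [L], as [dramp_out] requires.
    All the trapezoids vanish at both ends, hence the limit is the indicator of the open
    interval. *)
Lemma dramp_cvg (s L z : K) : 0 < L ->
  dramp s (s + L) (L * n.+2%:R^-1) z @[n --> \oo] --> (\1_(`]s, s + L[%classic) z : K).
Proof.
move=> L0.
have e0 n : 0 < L * n.+2%:R^-1 by rewrite mulr_gt0// invr_gt0.
have eL n : L * n.+2%:R^-1 < s + L - s.
  by rewrite addrAC subrr add0r gtr_pMr// invf_lt1// ltr1n.
rewrite indicE; have [|] := boolP (z \in `]s, s + L[%classic).
  rewrite inE /= in_itv/= => /andP[sz zt].
  have ce : L * n.+2%:R^-1 @[n --> \oo] --> 0.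
    rewrite -[X in _ --> X](mulr0 L); apply: cvgMr.
    have /= := @cvg_harmonic K; rewrite -(cvg_shiftS (@harmonic K)) /harmonic; exact.
  apply: (@cvg_trans _ ((1 : K) @[n --> \oo])); last exact: cvg_cst.
  apply: near_eq_cvg; near=> n.
  have ez : L * n.+2%:R^-1 < Num.min (z - s) (s + L - z).
    by near: n; apply: (cvgr_lt _ ce); rewrite lt_min !subr_gt0 sz zt.
  move: ez; rewrite lt_min => /andP[e1 e2].
  by rewrite dramp_in//; [rewrite addrC -ltrBrDr|rewrite ltrBrDl -ltrBrDr].
move=> /negP; rewrite inE /= in_itv/= => zst.
rewrite [X in _ --> X](_ : _ = 0)//.
apply: (@cvg_trans _ ((0 : K) @[n --> \oo])); last exact: cvg_cst.
apply: near_eq_cvg; apply: nearW => n; rewrite dramp_out//.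
have [zs|sz] := leP z s; first by left.
by right; rewrite leNgt; apply/negP => zt; apply: zst; rewrite sz zt.
Unshelve. all: by end_near. Qed.

Lemma Rintegral_dramp_cvg f s L : in_L2 a b f -> 0 < L -> a <= s -> s + L <= b ->
  (\int[mu]_(z in J) (f z * dramp s (s + L) (L * n.+2%:R^-1) z)) @[n --> \oo] -->
  \int[mu]_(z in `]s, s + L]) f z.
Proof.
move=> Lf L0 as_ sb.
have mJ : measurable (J : set (measurableTypeR K)) by exact: measurable_itv.
have If := in_L2_integrable Lf.
have mf : measurable_fun J f by case: Lf.
have mFn n : measurable_fun J
    (fun z => (f z * dramp s (s + L) (L * n.+2%:R^-1) z)%:E).
  apply/measurable_EFinP/measurable_funM => //.
  apply: measurable_funTS; apply: continuous_measurable_fun.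
  exact: continuous_dramp.
have mF : measurable_fun J (fun z => (f z * \1_(`]s, s + L[%classic) z)%:E).
  exact/measurable_EFinP/measurable_funM.
have cv : {ae mu, forall z, J z ->
    (f z * dramp s (s + L) (L * n.+2%:R^-1) z)%:E @[n --> \oo] -->
    (f z * \1_(`]s, s + L[%classic) z)%:E}.
  apply: aeW => z _; apply: cvg_EFin; first exact: nearW.
  by apply: cvgMr; exact: dramp_cvg.
have bd : {ae mu, forall z n, J z ->
    (`|(f z * dramp s (s + L) (L * n.+2%:R^-1) z)%:E| <= `|f z|%:E)%E}.
  apply: aeW => z n _; rewrite /= lee_fin normrM ler_piMr//.
  by apply: dramp_bound; rewrite mulr_gt0// invr_gt0.
have [_ _ H] := dominated_convergence mJ mFn mF cv (integrable_norm If) bd.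
have -> : \int[mu]_(z in `]s, s + L]) f z = \int[mu]_(z in J) (f z * \1_(`]s, s + L[%classic) z).
  rewrite -[LHS]Rintegral_itv_bndo_bndc; last first.
    apply: (@integrableS _ _ _ mu J) If => // z /=; rewrite !in_itv/= => /andP[sz zt].
    by rewrite (le_trans as_ (ltW sz)) (le_trans (ltW zt) sb).
  have E : `]s, s + L[%classic = J `&` `]s, s + L[%classic.
    apply/esym/setIidPr => z /=; rewrite !in_itv/= => /andP[sz zt].
    by rewrite (le_trans as_ (ltW sz)) (le_trans (ltW zt) sb).
  rewrite [in LHS]E Rintegral_mkcondr; apply: eq_Rintegral => z _.
  by rewrite patchE indicE; case: (z \in _); rewrite ?mulr1 ?mulr0.
apply: fine_cvg; move: H.
rewrite /Rintegral fineK//; apply: integrable_fin_num => //.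
apply: le_integrable If => //.
move=> z _ /=; rewrite lee_fin normrM ler_piMr// indicE.
by case: (_ \in _); rewrite ?normr1 ?normr0.
Qed.


Lemma cvg_derive1_right (F : K -> K) (u : K) : derivable F u 1 ->
  h^-1 * (F (h + u) - F u) @[h --> (0 : K)^'+] --> derive1 F u.
Proof.
move=> du; rewrite derive1E; apply: cvg_trans (cvg_dnbhs_at_right du).
by apply: near_eq_cvg; apply: nearW => h; rewrite /= [h *: _]mulr1.
Qed.

Lemma ae_derive1_Rintegral f : mu.-integrable J (EFin \o f) ->
  \forall x \ae mu, a < x -> x < b ->
    derivable (fun x => \int[mu]_(t in `[a, x]) (f \_ J) t) x 1 /\
    derive1 (fun x => \int[mu]_(t in `[a, x]) (f \_ J) t) x = f x.
Proof.
move=> If.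
have mJ : measurable (J : set (measurableTypeR K)) by exact: measurable_itv.
have IfJ y : mu.-integrable `[a, y] (EFin \o (f \_ J)).
  have : mu.-integrable setT (EFin \o (f \_ J)).
    by rewrite -restrict_EFin; exact/(integrable_mkcond _ mJ).1.
  exact: integrableS.
have := @FTC1 K (f \_ J) (BLeft a) IfJ (integrable_locally mJ If).
apply: (@filterS _ _ (ae_filter_ringOfSetsType mu)) => x Fx ax xb.
have [|dx ->] := Fx; first by rewrite lte_fin.
by split=> //; rewrite patchE ifT// inE /= in_itv/= !ltW.
Qed.

Lemma ae_neq (c : K) : \forall x \ae mu, x != c.
Proof.
exists [set c]; split; [exact: measurable_set1|exact: lebesgue_measure_set1|].
by move=> x /= /negP; rewrite negbK => /eqP.
Qed.

(** A nonempty open interval has positive measure and cannot lie inside the exceptional null set. *)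
Lemma ae_itv_inhabited (P : set K) (c d : K) : c < d -> (\forall x \ae mu, P x) ->
  exists x, [/\ c < x, x < d & P x].
Proof.
move=> cd [N [mN N0 subN]]; apply: contrapT => nx.
have : (mu `]c, d[ <= mu N)%E.
  apply: le_measure; rewrite ?inE//.
  move=> x /= xcd; apply: subN => /= Px; apply: nx; exists x.
  by move: xcd; rewrite in_itv/= => /andP[].
rewrite N0 lebesgue_measure_itv /= lte_fin cd -EFinD lee_fin.
by rewrite leNgt subr_gt0 cd.
Qed.

(* Testing against the difference of two translated trapezoids and letting their
   slopes tend to infinity shows that the integrals of f on intervals of the same
   length agree, so that the derivative of the primitive of f is constant. *)
Lemma du_bois_reymond f : in_L2 a b f ->
  (forall phi, test_C1 a b phi -> \int[mu]_(z in J) (f z * derive1 phi z) = 0) ->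
  exists c, f = cst c %[ae mu in J].
Proof.
move=> Lf f0.
have mJ : measurable (J : set (measurableTypeR K)) by exact: measurable_itv.
have If := in_L2_integrable Lf.
have eq_int s s' L : a < s -> s <= s' -> s' + L < b -> 0 < L ->
    \int[mu]_(z in `]s, s + L]) f z = \int[mu]_(z in `]s', s' + L]) f z.
  move=> as_ ss sb L0.
  have sb' : s + L <= b by lra.
  have as'_ : a <= s' by lra.
  have h1 := Rintegral_dramp_cvg Lf L0 (ltW as_) sb'.
  have h2 := Rintegral_dramp_cvg Lf L0 as'_ (ltW sb).
  rewrite -(cvg_lim (@Rhausdorff K) h1) -(cvg_lim (@Rhausdorff K) h2).
  apply: (congr1 (fun w : nat -> K => lim (w @ \oo))).
  apply/funext => n.
  have e0 : 0 < L / n.+2%:R by rewrite mulr_gt0// invr_gt0.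
  have eL : L / n.+2%:R < L by rewrite gtr_pMr// invf_lt1// ltr1n.
  have [tphi dphi] := test_C1_rampB as_ ss sb e0 eL.
  have := f0 _ tphi; rewrite dphi; under eq_Rintegral do rewrite mulrBr.
  have cL (r t e : K) : in_L2 a b (dramp r t e).
    by apply: continuous_in_L2; apply: continuous_subspaceT; exact: continuous_dramp.
  rewrite RintegralB//; [|exact: in_L2M_integrable..].
  by move=> /eqP; rewrite subr_eq0 => /eqP.
pose F x := \int[mu]_(t in `[a, x]) (f \_ J) t.
have aeF := ae_derive1_Rintegral If; rewrite -/F in aeF.
have IfJ y : mu.-integrable `[a, y] (EFin \o (f \_ J)).
  have : mu.-integrable setT (EFin \o (f \_ J)).
    by rewrite -restrict_EFin; exact/(integrable_mkcond _ mJ).1.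
  exact: integrableS.
have FB (x h : K) : a < x -> 0 < h -> x + h < b -> F (x + h) - F x = \int[mu]_(t in `]x, x + h]) f t.
  move=> ax h0 xb; rewrite /F (@Rintegral_itvB _ _ (BLeft a))//; last 2 first.
  - by rewrite bnd_simp (ltW ax).
  - by rewrite bnd_simp lerDl ltW.
  apply: eq_Rintegral => t; rewrite inE /= in_itv/= => /andP[xt th].
  by rewrite patchE ifT// inE /= in_itv/= (ltW (lt_trans ax xt)) (le_trans th (ltW xb)).
(* For small h > 0 the right difference quotients of [F] at x and at y are equal, by [FB] and
   [eq_int]; so are their limits. *)
have dF (x y : K) : a < x -> x < b -> a < y -> y < b -> derivable F x 1 -> derivable F y 1 ->
    derive1 F x = derive1 F y.
  wlog xy : x y / x <= y => [wlg ax xb ay yb dx dy|].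
    by have [|/ltW] := leP x y => ?; [|apply/esym]; exact: wlg.
  move=> ax xb ay yb dx dy.
  rewrite -(cvg_lim (@Rhausdorff K) (cvg_derive1_right dx)).
  apply: (cvg_lim (@Rhausdorff K)).
  apply: cvg_trans (cvg_derive1_right dy); apply: near_eq_cvg; near=> h.
  have h0 : 0 < h by near: h; exact: nbhs_right_gt.
  have hb : h < b - y by near: h; apply: nbhs_right_lt; rewrite subr_gt0.
  rewrite ![h + _]addrC !FB//; [|lra..].
  by congr (_ * _); apply/esym/eq_int => //; lra.
have [x0 [ax0 x0b Fx0]] := ae_itv_inhabited hab aeF.
have [dx0 {}Fx0] := Fx0 ax0 x0b.
exists (f x0).
apply: (@filterS3 _ _ (ae_filter_ringOfSetsType mu) _ _ _ _ _ aeF (ae_neq a) (ae_neq b)).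
move=> x Fx xa xb /=; rewrite in_itv/= => /andP[ax bx].
have {}ax : a < x by rewrite lt_neqAle eq_sym xa.
have {}bx : x < b by rewrite lt_neqAle xb.
have [dx <-] := Fx ax bx.
by rewrite -Fx0; exact: dF.
Unshelve. all: by end_near. Qed.

End DuBoisReymond.

(** * Sobolev functions *)

Section Sobolev.
Variables (K : realType) (a b : K).
Hypothesis hab : a < b.
Local Notation mu := (@lebesgue_measure K).
Local Notation J := `[a, b]%classic.
Implicit Types f g h u v : K -> K.

Lemma ae_filter : Filter (almost_everywhere mu).
Proof. exact: (ae_filter_ringOfSetsType mu). Qed.

Lemma aeq_trans T (f g h : K -> T) : f = g %[ae mu in J] -> g = h %[ae mu in J] ->
  f = h %[ae mu in J].
Proof. exact: ae_eq_trans. Qed.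

Lemma aeq_sym T (f g : K -> T) : f = g %[ae mu in J] -> g = f %[ae mu in J].
Proof. exact: ae_eq_sym. Qed.

Lemma ae_Rintegral f g : measurable_fun J f -> measurable_fun J g ->
  f = g %[ae mu in J] -> \int[mu]_(z in J) f z = \int[mu]_(z in J) g z.
Proof.
move=> mf mg fg; congr fine; apply: ae_eq_integral => //.
- exact/measurable_EFinP.
- exact/measurable_EFinP.
- by apply: (@filterS _ _ ae_filter _ _ _ fg) => z /[apply] ->.
Qed.

(** A difference that is nonzero at z stays nonzero on a relative neighbourhood of z, which has
    positive measure. This makes traces unique. *)
Lemma ae_eq_continuous u v : {within J, continuous u} -> {within J, continuous v} ->
  u = v %[ae mu in J] -> {in `[a, b], u =1 v}.
Proof.
move=> cu cv uv z zJ; apply/eqP/negPn/negP => uvz.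
have cw : {within J, continuous (fun x => `|u x - v x|)}.
  by move=> x; apply: cvg_norm; apply: cvgB; [exact: cu|exact: cv].
have w0 : 0 < `|u z - v z| by rewrite normr_gt0 subr_eq0.
have zJ' : J z by [].
have := (@subspace_continuousP _ _ _ _).1 cw z zJ'.
move=> /(cvgr_gt _ ) /(_ _ w0); rewrite near_withinE /= => /nbhs_ballP[e /= e0 he].
(* The ball meets ]a, b[ in a nonempty interval even when z is an endpoint, the case that matters
   for traces. *)
have lt1 : Num.max a (z - e) < Num.min b (z + e).
  move: zJ; rewrite in_itv /= => /andP[az zb].
  by rewrite gt_max !lt_min hab /=; apply/and3P; split; lra.
have [x [cx xd uvx]] := ae_itv_inhabited lt1 uv.
move: cx xd; rewrite gt_max lt_min => /andP[ax zx] /andP[xb xz].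
have xJ : J x by rewrite /= in_itv/= !ltW.
have : ball z e x by rewrite /ball /= ltr_norml; apply/andP; split; lra.
by move=> /he /(_ xJ); rewrite /from_subspace (uvx xJ) subrr normr0 ltxx.
Qed.

Lemma test_C1_in_L2 phi : test_C1 a b phi -> in_L2 a b phi /\ in_L2 a b (derive1 phi).
Proof. by case/test_C1_primitive => p _ _; split; [exact: primitive_in_L2 p|case: p]. Qed.

Lemma primitive_Rintegral g c : in_L2 a b g ->
  primitive a b (fun z => c + \int[mu]_(t in `[a, z]) g t) g.
Proof. by move=> Lg; split=> // z _; rewrite set_itv1 Rintegral_set1 addr0. Qed.

(** The primitive [H] of h has zero weak derivative, so it is constant by du Bois-Reymond, and zero
    because H a = 0; Lebesgue differentiation recovers h = H' = 0 almost everywhere. *)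
Lemma in_L2_ae0 h : in_L2 a b h ->
  (forall phi, test_C1 a b phi -> \int[mu]_(z in J) (h z * phi z) = 0) ->
  h = cst 0 %[ae mu in J].
Proof.
move=> Lh h0.
pose H z := 0 + \int[mu]_(t in `[a, z]) h t.
have pH : primitive a b H h by exact: primitive_Rintegral.
have [c Hc] : exists c, H = cst c %[ae mu in J].
  apply: du_bois_reymond => //; first exact: primitive_in_L2 pH.
  by move=> phi tphi; rewrite (primitive_weak_derivative hab pH)// h0// oppr0.
have {}Hc : {in `[a, b], H =1 cst c}.
  apply: ae_eq_continuous => //; first exact: primitive_continuous pH.
  by move=> x; exact: cvg_cst.
have Ha : H a = 0 by rewrite /H set_itv1 Rintegral_set1 addr0.
have c0 : c = 0 by rewrite -Ha Hc// in_itv/= lexx ltW.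
rewrite {}c0 in Hc.
have aeF := ae_derive1_Rintegral (in_L2_integrable Lh).
apply: (@filterS3 _ _ ae_filter _ _ _ _ _ aeF (ae_neq a) (ae_neq b)).
move=> x Fx xa xb /=; rewrite in_itv/= => /andP[ax bx].
have {}ax : a < x by rewrite lt_neqAle eq_sym xa.
have {}bx : x < b by rewrite lt_neqAle xb.
have [_ <-] := Fx ax bx.
rewrite derive1E -(@derive_cst K K^o K^o 0 x 1); apply: near_eq_derive.
near=> y.
have ay : a < y by near: y; exact: lt_nbhsr.
have yb : y < b by near: y; exact: lt_nbhsl.
have yab : y \in `[a, b] by rewrite in_itv/= !ltW.
rewrite -[RHS](Hc y yab) /H add0r; apply: eq_Rintegral => t; rewrite inE /= in_itv/= => /andP[ta ty].
by rewrite patchE ifT// inE /= in_itv/= ta (le_trans ty (ltW yb)).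
Unshelve. all: by end_near. Qed.

Lemma weak_derivative_ae f f' g : in_L2 a b f -> in_L2 a b f' ->
  f = f' %[ae mu in J] -> weak_derivative a b f g -> weak_derivative a b f' g.
Proof.
move=> [mf _] [mf' _] ff' fg phi tphi; rewrite -fg//.
have [_ [mphi _]] := test_C1_in_L2 tphi.
apply: ae_Rintegral; [exact: measurable_funM..|].
by apply: (@filterS _ _ ae_filter _ _ _ ff') => z /[apply] ->.
Qed.

Lemma weak_derivative_unique f g g' : in_L2 a b g -> in_L2 a b g' ->
  weak_derivative a b f g -> weak_derivative a b f g' -> g = g' %[ae mu in J].
Proof.
move=> Lg Lg' fg fg'.
have mJ : measurable (J : set (measurableTypeR K)) by exact: measurable_itv.
have : (fun z => g z + -1 * g' z) = cst 0 %[ae mu in J].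
  apply: in_L2_ae0; first by apply: in_L2D => //; exact: in_L2Z.
  move=> phi tphi; have [Lphi _] := test_C1_in_L2 tphi.
  under eq_Rintegral do rewrite mulrDl mulN1r mulNr.
  rewrite RintegralB//; [|exact: in_L2M_integrable..].
  have := fg' _ tphi; rewrite fg// => /oppr_inj ->.
  exact: subrr.
apply: (@filterS _ _ ae_filter) => z /[apply] /=.
by rewrite mulN1r => /eqP; rewrite subr_eq0 => /eqP.
Qed.

Lemma sobolev_in_L2 m f : sobolev a b m f -> in_L2 a b f.
Proof. by case: m => [|m] //= []. Qed.

Lemma sobolev_ae m f f' : in_L2 a b f' -> f = f' %[ae mu in J] ->
  sobolev a b m f -> sobolev a b m f'.
Proof.
case: m => [|m] //= Lf' ff' [Lf [g fg sg]]; split=> //; exists g => //.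
exact: weak_derivative_ae fg.
Qed.

(** The derivative chosen by [wderive] need not be the witness in the definition of [sobolev];
    uniqueness almost everywhere carries the regularity of the witness over to it. *)
Lemma wderiveP m f : sobolev a b m.+1 f ->
  weak_derivative a b f (wderive a b f) /\ sobolev a b m (wderive a b f).
Proof.
case=> Lf [g fg sg]; have Lg := sobolev_in_L2 sg.
have : [set g | in_L2 a b g /\ weak_derivative a b f g] (wderive a b f).
  by apply: (@xgetPex _ (cst 0)); exists g.
case=> Lw fw; split=> //.
by apply: sobolev_ae sg => //; exact: weak_derivative_unique fg fw.
Qed.

Lemma sobolev_iter m k f : (k <= m)%N -> sobolev a b m f ->
  sobolev a b (m - k) (iter k (wderive a b) f).
Proof.
elim: k => [|k IH] km sf; first by rewrite subn0.
rewrite iterS; apply: (proj2 (@wderiveP _ _ _)).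
by rewrite -subSn// subSS; apply: IH => //; exact: ltnW.
Qed.

(** f minus the integral of g has zero weak derivative, hence is a constant by du Bois-Reymond. *)
Lemma weak_derivative_primitive f g : in_L2 a b f -> in_L2 a b g ->
  weak_derivative a b f g -> exists2 u, primitive a b u g & f = u %[ae mu in J].
Proof.
move=> Lf Lg fg.
have mJ : measurable (J : set (measurableTypeR K)) by exact: measurable_itv.
pose G z := 0 + \int[mu]_(t in `[a, z]) g t.
have pG : primitive a b G g by exact: primitive_Rintegral.
have LG := primitive_in_L2 hab pG.
have [c Hc] : exists c, (fun z => f z + -1 * G z) = cst c %[ae mu in J].
  apply: du_bois_reymond => //; first by apply: in_L2D => //; exact: in_L2Z.
  move=> phi tphi; have [_ Lphi] := test_C1_in_L2 tphi.
  under eq_Rintegral do rewrite mulrDl mulN1r mulNr.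
  rewrite RintegralB//; [|exact: in_L2M_integrable..].
  by rewrite fg// (primitive_weak_derivative hab pG)// subrr.
exists (fun z => c + \int[mu]_(t in `[a, z]) g t); first exact: primitive_Rintegral.
apply: (@filterS _ _ ae_filter _ _ _ Hc) => z /[apply] /= <-.
by rewrite /G add0r mulN1r subrK.
Qed.

Lemma sobolev_primitive m k f : (k < m)%N -> sobolev a b m f ->
  exists2 u, primitive a b u (iter k.+1 (wderive a b) f) &
    iter k (wderive a b) f = u %[ae mu in J].
Proof.
move=> km sf; have := sobolev_iter (ltnW km) sf.
rewrite -[(m - k)%N]prednK ?subn_gt0// => sk.
have [wk swk] := wderiveP sk.
by apply: weak_derivative_primitive wk; [exact: sobolev_in_L2 sk|exact: sobolev_in_L2 swk].
Qed.

Lemma smooth_primitive f k : (forall k z, derivable (derive1n k f) z 1) ->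
  primitive a b (derive1n k f) (derive1n k.+1 f).
Proof.
move=> df; apply: derivable_primitive => // z.
apply: differentiable_continuous; apply/derivable1_diffP.
exact: (df k.+1).
Qed.

Lemma smooth_sobolev m f : (forall k z, derivable (derive1n k f) z 1) -> sobolev a b m f.
Proof.
elim: m f => [|m IH] f df; first exact: primitive_in_L2 (smooth_primitive 0 df).
have p := smooth_primitive 0 df.
split; first exact: primitive_in_L2 p.
exists (derive1 f); first exact: primitive_weak_derivative p.
by apply: IH => k z; rewrite -derive1Sn.
Qed.

Lemma smooth_iter_wderive f k : (forall k z, derivable (derive1n k f) z 1) ->
  iter k (wderive a b) f = derive1n k f %[ae mu in J].
Proof.
move=> df; elim: k => [|k IH]; first exact: aeW.
rewrite iterS.
have sk : sobolev a b 1 (iter k (wderive a b) f).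
  have := @sobolev_iter k.+1 k f (leqnSn k) (smooth_sobolev k.+1 df).
  by rewrite subSnn.
have [wk swk] := wderiveP sk.
have p := smooth_primitive k df.
apply: (weak_derivative_unique _ _ _ (primitive_weak_derivative hab p)).
- exact: sobolev_in_L2 swk.
- by case: p.
- by apply: weak_derivative_ae wk => //; [exact: sobolev_in_L2 sk|exact: primitive_in_L2 p].
Qed.

End Sobolev.

(** * Coefficients of the two-variable polynomial matrices *)

Section Coefficients.
Variable K : realType.

Lemma size_mxsize m n (A : 'M[{poly K}]_(m, n)) i j : (size (A i j) <= mxsize A)%N.
Proof.
apply: leq_trans (leq_bigmax (F := fun i => (\max_(j < n) size (A i j))%N) i).
exact: (leq_bigmax (F := fun j => size (A i j)) j).
Qed.

Lemma coefmx_eq0 m n (A : 'M[{poly K}]_(m, n)) k : (mxsize A <= k)%N -> coefmx k A = 0.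
Proof.
move=> Ak; apply/matrixP => i j; rewrite !mxE nth_default//.
exact: leq_trans (size_mxsize A i j) Ak.
Qed.

Lemma mxsize_leq m n (A : 'M[{poly K}]_(m, n)) N :
  (forall k, (N <= k)%N -> coefmx k A = 0) -> (mxsize A <= N)%N.
Proof.
move=> A0; apply/bigmax_leqP => i _; apply/bigmax_leqP => j _.
by apply/leq_sizeP => k /A0/matrixP/(_ i j); rewrite !mxE.
Qed.

Lemma diffop_widen der m n (A : 'M[{poly K}]_(m, n)) N (xi : K -> 'cV[K]_n) z :
  (mxsize A <= N)%N ->
  diffop der A xi z =
    \sum_(k < N) coefmx k A *m \col_i iter k der (component xi i) z.
Proof.
move=> AN; rewrite /diffop.
rewrite (big_ord_widen N (fun k => coefmx k A *m \col_i iter k der (component xi i) z) AN).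
rewrite [LHS]big_mkcond; apply: eq_bigr => k _; case: ifP => // /negbT.
by rewrite -leqNgt => /coefmx_eq0 ->; rewrite mul0mx.
Qed.

Lemma Theta_map (S T : nzRingType) (f : {rmorphism S -> T}) m :
  map_mx f (Theta S m) = Theta T m.
Proof. by rewrite /Theta map_block_mx !raddf0 map_mxN map_scalar_mx rmorph1. Qed.

Lemma Theta_unit m q (Y : 'M[K]_(m + m, q)) : (Theta K m)^T *m (Theta K m *m Y) = Y.
Proof.
rewrite mulmxA /Theta tr_block_mx mulmx_block !trmx0.
have -> : (- 1%:M : 'M[K]_m)^T = - 1%:M by rewrite linearN /= trmx1.
rewrite trmx1.
by rewrite !mulmx0 !mul0mx ?mulmxN ?mulNmx ?mulmx1 ?mulmx0 ?oppr0 ?opprK !addr0 !add0r -scalar_mx_block mul1mx.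
Qed.

Lemma coef_theta_form m n (A : 'M[{poly K}]_(m + m, n)) i j k l :
  (theta_form A i j)`_l`_k =
  ((coefmx k A)^T *m Theta K m *m coefmx l A) i j.
Proof.
rewrite /theta_form -(Theta_map (@polyC {poly K} \o @polyC K)) !mxE.
rewrite coef_sum coef_sum; apply: eq_bigr => r _; rewrite !mxE.
rewrite mulr_suml coef_sum coef_sum mulr_suml; apply: eq_bigr => s _; rewrite !mxE /=.
by rewrite -!mulrA !coefCM coef_map /= -polyCM coefMC.
Qed.

Lemma coef_zeta_plus_eta (q : {poly {poly K}}) k l :
  (zeta_plus_eta K * q)`_l`_k =
  (if k is k'.+1 then q`_l`_k' else 0) + (if l is l'.+1 then q`_l'`_k else 0).
Proof.
rewrite /zeta_plus_eta mulrDl !coefD coefCM coefXM coefXM.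
by case: k l => [|k] [|l] //=; rewrite coef0.
Qed.

End Coefficients.

(** * Coefficients of the boundary polynomial matrix and a bound on its order *)

Section BoundaryMatrix.
Variables (K : realType) (n p : nat).
Variables (R : 'M[{poly K}]_(n + n, n)) (Rb : 'M[{poly K}]_(p + p, n)).

(** The coefficient of zeta^k eta^l in [theta_form A]. *)
Definition theta_coef m (A : 'M[{poly K}]_(m + m, n)) k l : 'M[K]_n :=
  (coefmx k A)^T *m Theta K m *m coefmx l A.

Lemma theta_coef0l m (A : 'M[{poly K}]_(m + m, n)) k l :
  (mxsize A <= k)%N -> theta_coef A k l = 0.
Proof. by move=> Ak; rewrite /theta_coef coefmx_eq0// trmx0 !mul0mx. Qed.

Lemma theta_coef0r m (A : 'M[{poly K}]_(m + m, n)) k l :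
  (mxsize A <= l)%N -> theta_coef A k l = 0.
Proof. by move=> Ak; rewrite /theta_coef [coefmx l A]coefmx_eq0// mulmx0. Qed.

Hypothesis RRb : theta_form R = zeta_plus_eta K *: theta_form Rb.

(** Multiplication by zeta + eta raises exactly one of the two exponents by one; on jets this
    becomes the Leibniz rule. *)
Lemma theta_coef_rec k l : theta_coef R k l =
  (if k is k'.+1 then theta_coef Rb k' l else 0) +
  (if l is l'.+1 then theta_coef Rb k l' else 0).
Proof.
apply/matrixP => i j; rewrite -coef_theta_form RRb mxE coef_zeta_plus_eta [RHS]mxE.
by congr (_ + _); [case: k => [|k]|case: l => [|l]]; rewrite ?coef_theta_form// mxE.
Qed.

Lemma row_free_mxrow_inj m N q (B : 'I_N -> 'M[K]_(m, n)) (Y : 'M[K]_(m, q)) :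
  row_free (\mxrow_k B k) -> (forall k, (B k)^T *m Y = 0) -> Y = 0.
Proof.
move=> /row_freeP[D BD] BY.
have : (\mxrow_k B k)^T *m Y = 0.
  by rewrite tr_mxrow mxcol_mul; apply/mxcolP => k; rewrite mxcolK BY submxcol0.
move/(congr1 (mulmx D^T)); rewrite mulmx0 mulmxA -trmx_mul BD trmx1 mul1mx.
exact.
Qed.

Lemma row_free_mxrow_surj m N (B : 'I_N -> 'M[K]_(m, n)) (t : 'cV[K]_m) :
  row_free (\mxrow_k B k) -> exists v : 'I_N -> 'cV[K]_n, \sum_k B k *m v k = t.
Proof.
move=> /row_freeP[D BD]; exists (fun k => submxcol (D *m t) k).
by rewrite -mul_mxrow_mxcol submxcolK mulmxA BD mul1mx.
Qed.

(* Comparing the coefficients of the top power of eta in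
   theta_form R = (zeta + eta) theta_form Rb. *)
Lemma mxsize_boundary M : mxsize R = M.+1 ->
  row_free (\mxrow_(k < mxsize Rb) coefmx k Rb) -> (mxsize Rb <= M)%N.
Proof.
move=> RM rf; rewrite leqNgt; apply/negP => Ml.
case E : (mxsize Rb) Ml => [//|l]; rewrite ltnS => Ml.
suff : (mxsize Rb <= l)%N by rewrite E ltnn.
apply: mxsize_leq => k; rewrite leq_eqVlt => /predU1P[<-|lk]; last first.
  by apply: coefmx_eq0; rewrite E.
(* The power eta^(l+1) is absent from [theta_form R], as l >= M. Since [Rb] has degree l, its
   coefficient in the product is that of eta^l in [theta_form Rb]; full row rank then cancels the
   left factors. *)
have tY : Theta K p *m coefmx l Rb = 0.
  apply: (row_free_mxrow_inj rf) => k0; rewrite mulmxA -/(theta_coef Rb k0 l).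
  have := theta_coef_rec k0 l.+1.
  rewrite theta_coef0r ?RM// => /esym.
  have [->|k'] : nat_of_ord k0 = 0%N \/ exists k', nat_of_ord k0 = k'.+1.
  - by case: (nat_of_ord k0) => [|k']; [left|right; exists k'].
  - by rewrite add0r.
  by case: k' => k' ->; rewrite theta_coef0r ?E// add0r.
by rewrite -[LHS]Theta_unit tY mulmx0.
Qed.

End BoundaryMatrix.

(** * Hermite interpolation *)

Section Hermite.
Variable K : realType.
Implicit Types (q w : {poly K}) (c : K).

Lemma derivn_XsubC_exp_mul N k c w : (k < N)%N ->
  ((('X - c%:P) ^+ N * w)^`(k)).[c] = 0.
Proof.
elim: k N w => [|k IH] [//|N] w kN.
  by rewrite derivn0 exprS -mulrA hornerM hornerXsubC subrr mul0r.
have E : (('X - c%:P) ^+ N.+1 * w)^`() =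
    ('X - c%:P) ^+ N * (w *+ N.+1 + ('X - c%:P) * w^`()).
  rewrite derivM deriv_exp derivXsubC mul1r exprS.
  by rewrite mulrnAl mulrDr mulrnAr mulrA [X in _ + X * _]mulrC.
rewrite derivSn E.
exact: IH.
Qed.

Lemma derivn_comp_XsubC q k c : (q \Po ('X - c%:P))^`(k) = q^`(k) \Po ('X - c%:P).
Proof.
elim: k => [//|k IH]; rewrite !derivnS IH deriv_comp derivXsubC mulr1//.
Qed.

Lemma taylor_interpolation N c (s : nat -> K) :
  exists q, forall k, (k < N)%N -> q^`(k).[c] = s k.
Proof.
exists ((\poly_(k < N) (s k / k`!%:R)) \Po ('X - c%:P)) => k kN.
rewrite derivn_comp_XsubC horner_comp hornerXsubC subrr horner_coef0.
rewrite coef_derivn addn0 ffactnn coef_poly kN -(mulr_natr (s k / _)) divfK//.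
Qed.

(** Chinese remainder theorem: the derivatives of order below N at c depend only on the residue
    modulo (X - c)^N, and the powers at c and at d are coprime. The Bezout relation yields the
    interpolant. *)
Lemma hermite_interpolation N (c d : K) (s t : nat -> K) : c != d ->
  exists q, forall k, (k < N)%N -> q^`(k).[c] = s k /\ q^`(k).[d] = t k.
Proof.
move=> cd.
have [qc qcE] := taylor_interpolation N c s.
have [qd qdE] := taylor_interpolation N d t.
have cop : coprimep (('X - c%:P) ^+ N) (('X - d%:P) ^+ N).
  apply: coprimep_expl; apply: coprimep_expr.
  by rewrite coprimep_XsubC root_XsubC eq_sym.
have [[u v] /= uv] := Bezout_eq1_coprimepP _ _ cop.
exists (qd * (u * ('X - c%:P) ^+ N) + qc * (v * ('X - d%:P) ^+ N)) => k kN.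
have -> : qd * (u * ('X - c%:P) ^+ N) + qc * (v * ('X - d%:P) ^+ N) =
  qc + ('X - c%:P) ^+ N * (qd * u - qc * u).
  rewrite -[X in _ = X + _](mulr1 qc) -uv; ring.
split; first by rewrite derivnD hornerD derivn_XsubC_exp_mul// addr0 qcE.
have -> : qc + ('X - c%:P) ^+ N * (qd * u - qc * u) =
  qd + ('X - d%:P) ^+ N * (qc * v - qd * v).
  rewrite -[X in X + _ = _](mulr1 qc) -[X in _ = X + _](mulr1 qd) -uv; ring.
by rewrite derivnD hornerD derivn_XsubC_exp_mul// addr0 qdE.
Qed.

Lemma derive1n_horner q k : derive1n k (horner q) = horner (q^`(k)).
Proof. by elim: k => [//|k IH]; rewrite derive1nS IH -derivE derivnS. Qed.

Lemma derivable_derive1n_horner q k (z : K) : derivable (derive1n k (horner q)) z 1.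
Proof. by rewrite derive1n_horner; exact: derivable_horner. Qed.

End Hermite.

(** * The bilinear form of Theta, the Leibniz rule and the adjoint *)

Section ThetaPairing.
Variable K : realType.

Lemma dotE m (u v : 'cV[K]_m) : dot u v = \sum_i u i 0 * v i 0.
Proof. by rewrite /dot mxE; apply: eq_bigr => i _; rewrite mxE. Qed.

Lemma dotC m (u v : 'cV[K]_m) : dot u v = dot v u.
Proof. by rewrite !dotE; apply: eq_bigr => i _; rewrite mulrC. Qed.

Lemma dotBr m (u v w : 'cV[K]_m) : dot u (v - w) = dot u v - dot u w.
Proof. by rewrite /dot mulmxBr !mxE. Qed.

Lemma dot0l m (u : 'cV[K]_m) : dot 0 u = 0.
Proof. by rewrite /dot trmx0 mul0mx mxE. Qed.

Lemma dot_mulmxr m q (A : 'M[K]_(m, q)) u v : dot u (A *m v) = dot (A^T *m u) v.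
Proof. by rewrite /dot trmx_mul trmxK mulmxA. Qed.

Lemma dot_Theta_col m (x1 e1 x2 e2 : 'cV[K]_m) :
  dot (col_mx x1 e1) (Theta K m *m col_mx x2 e2) = dot e1 x2 - dot x1 e2.
Proof.
rewrite /dot /Theta tr_col_mx mul_block_col !mul0mx add0r addr0 mul1mx mulNmx mul1mx.
by rewrite mul_row_col mulmxN !mxE addrC.
Qed.

Lemma dot_Theta_eq0 m (y : 'cV[K]_(m + m)) :
  (forall t, dot t (Theta K m *m y) = 0) -> y = 0.
Proof.
move=> y0; rewrite -(Theta_unit y) (_ : Theta K m *m y = 0) ?mulmx0//.
apply/matrixP => i j; rewrite (ord1 j) [RHS]mxE -(y0 (delta_mx i 0)) dotE.
rewrite (bigD1 i)//= big1 ?addr0; first by rewrite [delta_mx _ _ _ _]mxE !eqxx mul1r.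
by move=> k ki; rewrite [delta_mx _ _ _ _]mxE (negbTE ki) mul0r.
Qed.

(** The form u^T X v expanded so that each summand is a constant times a product of two scalars,
    ready for scalar integration by parts. *)
Definition pairing n (X : 'M[K]_n) (u v : 'cV[K]_n) : K :=
  \sum_i \sum_j X i j * (u i 0 * v j 0).

Lemma pairingE n (X : 'M[K]_n) u v : dot u (X *m v) = pairing X u v.
Proof.
rewrite dotE; apply: eq_bigr => i _; rewrite mxE mulr_sumr.
by apply: eq_bigr => j _; rewrite mulrCA.
Qed.

Lemma pairingDl n (X Y : 'M[K]_n) u v : pairing (X + Y) u v = pairing X u v + pairing Y u v.
Proof. by rewrite -!pairingE /dot mulmxDl mulmxDr mxE. Qed.

Lemma pairing0 n (u v : 'cV[K]_n) : pairing 0 u v = 0.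
Proof. by rewrite -pairingE mul0mx dotC dot0l. Qed.

Lemma dot_theta_sum m n (A : 'M[{poly K}]_(m + m, n)) N (u v : nat -> 'cV[K]_n) :
  dot (\sum_(k < N) coefmx k A *m u k) (Theta K m *m \sum_(l < N) coefmx l A *m v l) =
  \sum_(k < N) \sum_(l < N) pairing (theta_coef A k l) (u k) (v l).
Proof.
rewrite /dot raddf_sum /= mulmx_sumr mulmx_suml summxE; apply: eq_bigr => k _.
rewrite mulmx_sumr summxE; apply: eq_bigr => l _.
by rewrite /= -pairingE /dot /theta_coef trmx_mul !mulmxA.
Qed.

(** When [u] and [v] list the successive derivatives of two functions, the right-hand side is the
    formal derivative of the form of [Rb]. For arbitrary sequences the identity is pure algebra, so
    it can be applied pointwise to the chosen weak derivatives. *)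
Lemma pairing_leibniz n p (R : 'M[{poly K}]_(n + n, n)) (Rb : 'M[{poly K}]_(p + p, n)) M
    (u v : nat -> 'cV[K]_n) :
  theta_form R = zeta_plus_eta K *: theta_form Rb -> (mxsize Rb <= M)%N ->
  \sum_(k < M.+1) \sum_(l < M.+1) pairing (theta_coef R k l) (u k) (v l) =
  \sum_(k < M) \sum_(l < M) (pairing (theta_coef Rb k l) (u k.+1) (v l) +
                             pairing (theta_coef Rb k l) (u k) (v l.+1)).
Proof.
move=> RRb RbM.
under eq_bigr do under eq_bigr do rewrite (theta_coef_rec RRb) pairingDl.
under eq_bigr do rewrite big_split /=.
under [RHS]eq_bigr do rewrite big_split /=.
rewrite [LHS]big_split [RHS]big_split /=; congr (_ + _).
  (* The shift in zeta leaves nothing in the row k = 0, and the column l = M vanishes because [Rb]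
     has order below M. The shift in eta is symmetric. *)
  rewrite big_ord_recl big1 ?add0r => [|l _]; last by rewrite pairing0.
  apply: eq_bigr => k _; rewrite big_ord_recr /= theta_coef0r// pairing0 addr0.
  by [].
rewrite big_ord_recr /= [X in _ + X]big1 ?addr0 => [|[[|l] lM] _] /=; last 2 first.
- by rewrite pairing0.
- by rewrite theta_coef0l// pairing0.
by apply: eq_bigr => k _; rewrite big_ord_recl /= pairing0 add0r.
Qed.

(** The adjoint is involutive and reverses products. Thus the operator that [distr_ker] applies to
    test functions is Theta^T R, which turns the distributional equation into a pairing with
    elements R phi. *)
Lemma formal_adjoint_Theta m n (A : 'M[{poly K}]_(m + m, n)) :
  formal_adjoint (formal_adjoint A *m Theta _ m) = (Theta _ m)^T *m A.
Proof.
have compN : cancel (fun q : {poly K} => q \Po (- 'X)) (fun q => q \Po (- 'X)).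
  by move=> q; rewrite -comp_polyA linearN /= comp_polyX opprK comp_polyXr.
rewrite /formal_adjoint trmx_mul; set f := (fun q : {poly K} => q \Po - 'X) in compN *.
rewrite -[f]/(comp_poly (- 'X)) map_mxM; congr (_ *m _).
  by rewrite -map_trmx Theta_map.
by apply/matrixP => i j; rewrite !mxE; exact: compN.
Qed.

Lemma coefmx_Theta_mul m n (A : 'M[{poly K}]_(m + m, n)) k :
  coefmx k ((Theta _ m)^T *m A) = (Theta K m)^T *m coefmx k A.
Proof.
apply/matrixP => i j; rewrite !mxE coef_sum; apply: eq_bigr => r _.
by rewrite -(Theta_map (@polyC K)) !mxE coefCM.
Qed.

Lemma diffop_Theta_mul der m n (A : 'M[{poly K}]_(m + m, n)) xi z :
  diffop der ((Theta _ m)^T *m A) xi z = (Theta K m)^T *m diffop der A xi z.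
Proof.
pose N := maxn (mxsize A) (mxsize ((Theta {poly K} m)^T *m A)).
rewrite (@diffop_widen _ _ _ _ _ N) ?leq_maxr// (@diffop_widen _ _ _ _ A N) ?leq_maxl//.
by rewrite mulmx_sumr; apply: eq_bigr => k _; rewrite coefmx_Theta_mul mulmxA.
Qed.

End ThetaPairing.

(** * Green identity *)

Section Jets.
Variables (K : realType) (a b : K).
Hypothesis hab : a < b.
Local Notation mu := (@lebesgue_measure K).
Local Notation J := `[a, b]%classic.
Local Notation wder := (wderive a b).

(** Integrability is bundled with the value, so that finite linear combinations are integrated
    without side conditions. *)
Definition has_Rintegral (g : K -> K) (d : K) : Prop :=
  mu.-integrable J (EFin \o g) /\ \int[mu]_(z in J) g z = d.

Lemma has_RintegralD f g c d : has_Rintegral f c -> has_Rintegral g d ->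
  has_Rintegral (fun z => f z + g z) (c + d).
Proof.
move=> [If <-] [Ig <-]; have mJ : measurable (J : set (measurableTypeR K)) by exact: measurable_itv.
split; last by rewrite RintegralD.
by have := integrableD mJ If Ig; apply: eq_integrable => // z _ /=; rewrite EFinD.
Qed.

Lemma has_RintegralZ r f c : has_Rintegral f c -> has_Rintegral (fun z => r * f z) (r * c).
Proof.
move=> [If <-]; have mJ : measurable (J : set (measurableTypeR K)) by exact: measurable_itv.
split; last by rewrite RintegralZl.
by have := integrableZl mJ r If; apply: eq_integrable => // z _ /=; rewrite EFinM.
Qed.

Lemma has_Rintegral_sum (I : Type) (s : seq I) (f : I -> K -> K) (c : I -> K) :
  (forall i, has_Rintegral (f i) (c i)) ->
  has_Rintegral (fun z => \sum_(i <- s) f i z) (\sum_(i <- s) c i).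
Proof.
have mJ : measurable (J : set (measurableTypeR K)) by exact: measurable_itv.
move=> fc; elim: s => [|i s IH].
  rewrite big_nil; under [X in has_Rintegral X _]eq_fun do rewrite big_nil.
  split; last by rewrite Rintegral_cst// mul0r.
  by apply: in_L2_integrable; apply: continuous_in_L2 => x; exact: cvg_cst.
rewrite big_cons; under [X in has_Rintegral X _]eq_fun do rewrite big_cons.
exact: has_RintegralD.
Qed.

Lemma has_Rintegral_ae f g c : measurable_fun J f -> f = g %[ae mu in J] ->
  has_Rintegral g c -> has_Rintegral f c.
Proof.
move=> mf fg [Ig <-]; have mJ : measurable (J : set (measurableTypeR K)) by exact: measurable_itv.
have mg : measurable_fun J g by apply/measurable_EFinP; exact: measurable_int Ig.
split; last exact: ae_Rintegral.
have /integrableP[_ gfin] := Ig; apply/integrableP; split; first exact/measurable_EFinP.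
rewrite (_ : \int[mu]_(x in J) `|(EFin \o f) x| = \int[mu]_(x in J) `|(EFin \o g) x|)%E//.
apply: ae_eq_integral => //.
- by apply/measurable_EFinP; exact: measurableT_comp.
- by apply/measurable_EFinP; exact: measurableT_comp.
- by apply: (@filterS _ _ (@ae_filter K) _ _ _ fg) => z /[apply] /= ->.
Qed.

(** [U k] is the absolutely continuous representative of the k-th weak derivative, for k < M only;
    its values at a and b are the traces. *)
Definition jet M n (xi : K -> 'cV[K]_n) (U : nat -> K -> 'cV[K]_n) : Prop :=
  forall k i, (k < M)%N ->
    primitive a b (fun z => U k z i 0) (iter k.+1 wder (component xi i)) /\
    iter k wder (component xi i) = (fun z => U k z i 0) %[ae mu in J].

Lemma sobolev_jet M n (xi : K -> 'cV[K]_n) : sobolevv a b M xi -> exists U, jet M xi U.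
Proof.
move=> sxi.
have /choice[u uP] : forall ki : nat * 'I_n, exists u : K -> K, (ki.1 < M)%N ->
    primitive a b u (iter ki.1.+1 wder (component xi ki.2)) /\
    iter ki.1 wder (component xi ki.2) = u %[ae mu in J].
  move=> [k i] /=; have [kM|kM] := boolP (k < M)%N; last by exists (cst 0).
  by have [u pu eu] := sobolev_primitive hab kM (sxi i); exists u.
exists (fun k z => \col_i u (k, i) z) => k i kM.
have [pu eu] := uP (k, i) kM; split.
  by rewrite (_ : (fun z => _) = u (k, i)) //; apply/funext => z; rewrite mxE.
by apply: (@filterS _ _ (@ae_filter K) _ _ _ eu) => z uz zJ; rewrite mxE; exact: uz.
Qed.

Lemma is_tracevE m (f g : K -> 'cV[K]_m) z t : z \in `[a, b] ->
  (forall i, {within J, continuous (component g i)}) -> eq_aev a b f g ->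
  is_tracev a b f z t <-> t = g z.
Proof.
move=> zJ cg fg.
have fgi i : component f i = component g i %[ae mu in J].
  by apply: (@filterS _ _ (@ae_filter K) _ _ _ fg) => x /[apply]; rewrite /component => ->.
split=> [ft|-> i]; last by exists (component g i).
apply/matrixP => i j; rewrite (ord1 j); have [h [ch fh <-]] := ft i.
apply: (ae_eq_continuous hab ch (cg i)) => //.
exact: aeq_trans (aeq_sym fh) (fgi i).
Qed.

Lemma eq_aev_col m (f g : K -> 'cV[K]_m) :
  (forall i, component f i = component g i %[ae mu in J]) -> eq_aev a b f g.
Proof.
move=> fg; have := filter_forall (@ae_filter K) fg.
apply: (@filterS _ _ (@ae_filter K)) => z fgz zJ; apply/matrixP => i j.
by rewrite (ord1 j); exact: fgz.
Qed.

Lemma component_sum_mul m n N (A : nat -> 'M[K]_(m, n)) (V : nat -> K -> 'cV[K]_n) i :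
  component (fun z => \sum_(k < N) A k *m V k z) i =
  (fun z => \sum_(k < N) \sum_j A k i j * V k z j 0).
Proof.
by apply/funext => z; rewrite /component summxE; apply: eq_bigr => k _; rewrite mxE.
Qed.

Lemma in_L2v_sum_mul m n N (A : nat -> 'M[K]_(m, n)) (V : nat -> K -> 'cV[K]_n) :
  (forall k i, (k < N)%N -> in_L2 a b (component (V k) i)) ->
  in_L2v a b (fun z => \sum_(k < N) A k *m V k z).
Proof.
move=> LV i; rewrite component_sum_mul; apply: in_L2_sum => k; apply: in_L2_sum => j.
by apply: in_L2Z; exact: LV.
Qed.

Lemma within_continuous_sum (I : Type) (s : seq I) (F : I -> K -> K) :
  (forall i, {within J, continuous (F i)}) ->
  {within J, continuous (fun z => \sum_(i <- s) F i z)}.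
Proof.
move=> cF; elim: s => [|i s IH].
  have -> : (fun z => \sum_(i <- [::]) F i z) = cst 0 by apply/funext => z; rewrite big_nil.
  by move=> x; exact: cvg_cst.
have -> : (fun z => \sum_(j <- i :: s) F j z) = (fun z => F i z + \sum_(j <- s) F j z).
  by apply/funext => z; rewrite big_cons.
by move=> x; apply: cvgD; [exact: cF|exact: IH].
Qed.

Lemma continuous_sum_mul m n N (A : nat -> 'M[K]_(m, n)) (V : nat -> K -> 'cV[K]_n) i :
  (forall k j, (k < N)%N -> {within J, continuous (component (V k) j)}) ->
  {within J, continuous (component (fun z => \sum_(k < N) A k *m V k z) i)}.
Proof.
move=> cV; rewrite component_sum_mul.
apply: within_continuous_sum => k; apply: within_continuous_sum => j x.
by apply: cvgMr; exact: cV.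
Qed.

Lemma eq_aev_sum_mul m n N (A : nat -> 'M[K]_(m, n)) (V W : nat -> K -> 'cV[K]_n) :
  (forall k, (k < N)%N -> eq_aev a b (V k) (W k)) ->
  eq_aev a b (fun z => \sum_(k < N) A k *m V k z) (fun z => \sum_(k < N) A k *m W k z).
Proof.
move=> VW; have := filter_forall (@ae_filter K) (fun k : 'I_N => VW k (ltn_ord k)).
apply: (@filterS _ _ (@ae_filter K)) => z VWz zJ.
by apply: eq_bigr => k _; rewrite VWz.
Qed.

Lemma diffop_wderive_in_L2 M m n (A : 'M[{poly K}]_(m, n)) xi :
  (mxsize A <= M.+1)%N -> sobolevv a b M xi -> in_L2v a b (diffop wder A xi).
Proof.
move=> AM sxi; rewrite (_ : diffop _ _ _ = fun z => \sum_(k < M.+1) coefmx k A *m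
    \col_i iter k wder (component xi i) z); last first.
  by apply/funext => z; exact: diffop_widen.
apply: (in_L2v_sum_mul (fun k => coefmx k A)
  (V := fun k z => \col_i iter k wder (component xi i) z)) => k i kM.
rewrite (_ : component _ _ = iter k wder (component xi i)); last first.
  by apply/funext => z; rewrite /component mxE.
move: kM; rewrite ltnS => kM; exact: (sobolev_in_L2 (sobolev_iter hab kM (sxi i))).
Qed.

Lemma diffop_jet M m n (A : 'M[{poly K}]_(m, n)) xi U : (mxsize A <= M)%N -> jet M xi U ->
  (forall i, {within J, continuous (component (fun z => \sum_(k < M) coefmx k A *m U k z) i)}) /\
  eq_aev a b (diffop wder A xi) (fun z => \sum_(k < M) coefmx k A *m U k z).
Proof.
move=> AM jU; split.
  move=> i; apply: (@continuous_sum_mul m n M (fun k => coefmx k A) U i) => k j kM.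
  exact: primitive_continuous (proj1 (jU k j kM)).
rewrite (_ : diffop _ _ _ = fun z => \sum_(k < M) coefmx k A *m
    \col_i iter k wder (component xi i) z); last first.
  by apply/funext => z; exact: diffop_widen.
apply: (eq_aev_sum_mul (fun k => coefmx k A)
  (V := fun k z => \col_i iter k wder (component xi i) z)) => k kM.
apply: eq_aev_col => i; rewrite (_ : component _ _ = iter k wder (component xi i)); last first.
  by apply/funext => z; rewrite /component mxE.
exact: (proj2 (jU k i kM)).
Qed.

(** Factors of order k and l are replaced by their continuous representatives. Those of order k + 1
    and l + 1, possibly M, stay merely square-integrable, as [primitive_by_parts] allows. *)
Lemma jet_product M n (xi eta : K -> 'cV[K]_n) U V k l i j :
  sobolevv a b M xi -> sobolevv a b M eta -> jet M xi U -> jet M eta V ->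
  (k < M)%N -> (l < M)%N ->
  has_Rintegral (fun z =>
      iter k.+1 wder (component xi i) z * iter l wder (component eta j) z +
      iter k wder (component xi i) z * iter l.+1 wder (component eta j) z)
    (U k b i 0 * V l b j 0 - U k a i 0 * V l a j 0).
Proof.
move=> sxi seta jU jV kM lM.
have [pU eU] := jU k i kM; have [pV eV] := jV l j lM.
have Lxi k' : (k' <= M)%N -> in_L2 a b (iter k' wder (component xi i)).
  by move=> k'M; exact: sobolev_in_L2 (sobolev_iter hab k'M (sxi i)).
have Leta k' : (k' <= M)%N -> in_L2 a b (iter k' wder (component eta j)).
  by move=> k'M; exact: sobolev_in_L2 (sobolev_iter hab k'M (seta j)).
apply: (has_Rintegral_ae (g := fun z =>
    iter k.+1 wder (component xi i) z * V l z j 0 +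
    U k z i 0 * iter l.+1 wder (component eta j) z)).
- apply: measurable_funD; apply: measurable_funM.
  + by case: (Lxi k.+1 kM).
  + by case: (Leta l (ltnW lM)).
  + by case: (Lxi k (ltnW kM)).
  + by case: (Leta l.+1 lM).
- apply: (@filterS2 _ _ (@ae_filter K) _ _ _ _ eU eV) => z Uz Vz zJ.
  by rewrite Uz// Vz.
- split; last exact: (primitive_by_parts hab pU pV).
  have mJ : measurable (J : set (measurableTypeR K)) by exact: measurable_itv.
  have LU := primitive_in_L2 hab pU; have LV := primitive_in_L2 hab pV.
  have := integrableD mJ (in_L2M_integrable (Lxi k.+1 kM) LV) (in_L2M_integrable LU (Leta l.+1 lM)).
  by apply: eq_integrable => // z _ /=; rewrite EFinD.
Qed.

End Jets.

(** * The Green identity, isotropy, and smooth elements of LR *)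

Section Green.
Variables (K : realType) (a b : K).
Hypothesis hab : a < b.
Local Notation mu := (@lebesgue_measure K).
Local Notation J := `[a, b]%classic.
Local Notation wder := (wderive a b).
Variables (n p M : nat).
Variables (R : 'M[{poly K}]_(n + n, n)) (Rb : 'M[{poly K}]_(p + p, n)).
Hypothesis RM : (mxsize R <= M.+1)%N.
Hypothesis RbM : (mxsize Rb <= M)%N.
Hypothesis RRb : theta_form R = zeta_plus_eta K *: theta_form Rb.

Definition jet_trace (U : nat -> K -> 'cV[K]_n) (z : K) : 'cV[K]_(p + p) :=
  \sum_(k < M) coefmx k Rb *m U k z.

(** The Leibniz identity turns the integrand, pointwise, into a finite linear combination of formal
    derivatives of scalar products, each integrated by [jet_product]. *)
Lemma green (xi eta : K -> 'cV[K]_n) U V :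
  sobolevv a b M xi -> sobolevv a b M eta -> jet a b M xi U -> jet a b M eta V ->
  has_Rintegral a b
    (fun z => dot (diffop wder R xi z) (Theta K n *m diffop wder R eta z))
    (dot (jet_trace U b) (Theta K p *m jet_trace V b) -
     dot (jet_trace U a) (Theta K p *m jet_trace V a)).
Proof.
move=> sxi seta jU jV.
rewrite (_ : (fun z => _) = fun z => \sum_(k < M) \sum_(l < M) \sum_i \sum_j
    theta_coef Rb k l i j *
      (iter k.+1 wder (component xi i) z * iter l wder (component eta j) z +
       iter k wder (component xi i) z * iter l.+1 wder (component eta j) z)); last first.
  apply/funext => z; rewrite !(@diffop_widen _ _ _ _ R M.+1)//.
  pose jc (f : K -> 'cV[K]_n) k := \col_i iter k wder (component f i) z.
  rewrite (@dot_theta_sum _ _ _ R M.+1 (jc xi) (jc eta)).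
  rewrite (@pairing_leibniz _ _ _ R Rb M (jc xi) (jc eta) RRb RbM).
  apply: eq_bigr => k _; apply: eq_bigr => l _.
  rewrite /pairing -big_split; apply: eq_bigr => i _; rewrite -big_split.
  by apply: eq_bigr => j _; rewrite /= !mxE mulrDr.
rewrite /jet_trace (@dot_theta_sum _ _ _ Rb M (fun k => U k b) (fun k => V k b)).
rewrite (@dot_theta_sum _ _ _ Rb M (fun k => U k a) (fun k => V k a)).
rewrite -sumrB; apply: has_Rintegral_sum => k.
rewrite -sumrB; apply: has_Rintegral_sum => l.
rewrite /pairing -sumrB; apply: has_Rintegral_sum => i.
rewrite -sumrB; apply: has_Rintegral_sum => j.
by rewrite -mulrBr; apply: has_RintegralZ; exact: jet_product.
Qed.

Lemma in_L2v_pairing_measurable m (X : 'M[K]_m) (f g : K -> 'cV[K]_m) :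
  in_L2v a b f -> in_L2v a b g -> measurable_fun J (fun z => dot (f z) (X *m g z)).
Proof.
move=> Lf Lg.
have : has_Rintegral a b (fun z => \sum_i \sum_j X i j * (f z i 0 * g z j 0))
    (\sum_i \sum_j X i j * \int[mu]_(z in J) (f z i 0 * g z j 0)).
  apply: has_Rintegral_sum => i; apply: has_Rintegral_sum => j.
  by apply: has_RintegralZ; split=> //; exact: in_L2M_integrable (Lf i) (Lg j).
rewrite (_ : (fun z => dot _ _) = fun z => \sum_i \sum_j X i j * (f z i 0 * g z j 0)).
  by case=> /(measurable_int mu)/measurable_EFinP.
by apply/funext => z; rewrite pairingE.
Qed.

Lemma alternate_productE (c1 c2 : ext K n p) : alternate_product a b c1 c2 =
  \int[mu]_(z in J) dot (col_mx (ext_x c1 z) (ext_e c1 z))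
                        (Theta K n *m col_mx (ext_x c2 z) (ext_e c2 z))
  - (dot (col_mx (ext_chi c1).2 (ext_eps c1).2)
         (Theta K p *m col_mx (ext_chi c2).2 (ext_eps c2).2)
     - dot (col_mx (ext_chi c1).1 (ext_eps c1).1)
         (Theta K p *m col_mx (ext_chi c2).1 (ext_eps c2).1)).
Proof.
rewrite /alternate_product !dot_Theta_col; congr (_ - _).
by apply: eq_Rintegral => z _; rewrite dot_Theta_col [dot (ext_e c2 z) _]dotC.
Qed.

Lemma in_L2v_col (x e : K -> 'cV[K]_n) :
  in_L2v a b x -> in_L2v a b e -> in_L2v a b (fun z => col_mx (x z) (e z)).
Proof.
move=> Lx Le i; rewrite /component.
have [j|j] := split_ordP i => ->.
  by rewrite (_ : (fun z => _) = component x j)//; apply/funext => z; rewrite col_mxEu.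
by rewrite (_ : (fun z => _) = component e j)//; apply/funext => z; rewrite col_mxEd.
Qed.

Lemma alternate_product_green (c1 c2 : ext K n p) xi eta U V :
  extended_space a b c1 -> extended_space a b c2 ->
  sobolevv a b M xi -> sobolevv a b M eta -> jet a b M xi U -> jet a b M eta V ->
  eq_aev a b (fun z => col_mx (ext_x c1 z) (ext_e c1 z)) (diffop wder R xi) ->
  eq_aev a b (fun z => col_mx (ext_x c2 z) (ext_e c2 z)) (diffop wder R eta) ->
  alternate_product a b c1 c2 =
  (dot (jet_trace U b) (Theta K p *m jet_trace V b) -
   dot (jet_trace U a) (Theta K p *m jet_trace V a))
  - (dot (col_mx (ext_chi c1).2 (ext_eps c1).2)
         (Theta K p *m col_mx (ext_chi c2).2 (ext_eps c2).2)
     - dot (col_mx (ext_chi c1).1 (ext_eps c1).1)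
         (Theta K p *m col_mx (ext_chi c2).1 (ext_eps c2).1)).
Proof.
move=> [Lx1 Le1] [Lx2 Le2] sxi seta jU jV w1 w2.
rewrite alternate_productE; congr (_ - _).
have [_ <-] := green sxi seta jU jV; apply: ae_Rintegral.
- by apply: in_L2v_pairing_measurable; exact: in_L2v_col.
- by apply: in_L2v_pairing_measurable; [exact: (diffop_wderive_in_L2 hab RM sxi)|exact: (diffop_wderive_in_L2 hab RM seta)].
- by apply: (@filterS2 _ _ (@ae_filter K) _ _ _ _ w1 w2) => z w1z w2z zJ; rewrite w1z// w2z.
Qed.

(** Trades the trace relation, quantified over continuous representatives, for plain values of one
    jet, the form in which the Green identity delivers its boundary terms. *)
Lemma LR_jet (c : ext K n p) : LR a b M R Rb c <-> extended_space a b c /\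
  exists xi U, [/\ sobolevv a b M xi, jet a b M xi U,
    eq_aev a b (fun z => col_mx (ext_x c z) (ext_e c z)) (diffop wder R xi),
    col_mx (ext_chi c).1 (ext_eps c).1 = jet_trace U a &
    col_mx (ext_chi c).2 (ext_eps c).2 = jet_trace U b].
Proof.
have aJ : a \in `[a, b] by rewrite in_itv/= lexx ltW.
have bJ : b \in `[a, b] by rewrite in_itv/= lexx ltW.
split=> -[Lc].
  case=> xi [sxi w ta tb]; split=> //; have [U jU] := sobolev_jet hab sxi.
  have [cU eU] := diffop_jet hab RbM jU.
  by exists xi, U; split=> //;
    [exact: (is_tracevE hab _ aJ cU eU).1 ta|exact: (is_tracevE hab _ bJ cU eU).1 tb].
case=> xi [U [sxi jU w ta tb]]; split=> //; exists xi.
have [cU eU] := diffop_jet hab RbM jU.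
by split=> //;
  [exact: (is_tracevE hab _ aJ cU eU).2 ta|exact: (is_tracevE hab _ bJ cU eU).2 tb].
Qed.

Lemma LR_isotropic c1 c2 : LR a b M R Rb c1 -> LR a b M R Rb c2 ->
  alternate_product a b c1 c2 = 0.
Proof.
move=> /LR_jet[L1 [xi [U [sxi jU w1 ta1 tb1]]]] /LR_jet[L2 [eta [V [seta jV w2 ta2 tb2]]]].
rewrite (alternate_product_green L1 L2 sxi seta jU jV w1 w2).
by rewrite ta1 tb1 ta2 tb2 subrr.
Qed.

Section Smooth.
Variable phi : K -> 'cV[K]_n.
Hypothesis dphi : forall i k z, derivable (derive1n k (component phi i)) z 1.

(** The element generated by a smooth [phi], built from classical derivatives so that its boundary
    components are genuine pointwise values. *)
Definition smooth_ext : ext K n p :=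
  let w := diffop (@derive1 K K) R phi in
  let t := diffop (@derive1 K K) Rb phi in
  Ext (fun z => usubmx (w z)) (fun z => dsubmx (w z))
      (usubmx (t a), usubmx (t b)) (dsubmx (t a), dsubmx (t b)).

Let smooth_continuous k i : {within J, continuous (derive1n k (component phi i))}.
Proof. exact: (primitive_continuous hab (smooth_primitive a b k (@dphi i))). Qed.

Let colE k i : component (fun z => \col_i iter k (@derive1 K K) (component phi i) z) i =
  derive1n k (component phi i).
Proof. by apply/funext => z; rewrite /component mxE. Qed.

Lemma diffop_smooth_continuous m (A : 'M[{poly K}]_(m, n)) i :
  {within J, continuous (component (diffop (@derive1 K K) A phi) i)}.
Proof.
apply: (@continuous_sum_mul _ _ _ m n _ (fun k => coefmx k A)
  (fun k z => \col_i iter k (@derive1 K K) (component phi i) z)) => k j _.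
by rewrite colE; exact: smooth_continuous.
Qed.

Lemma diffop_smooth_ae m (A : 'M[{poly K}]_(m, n)) :
  eq_aev a b (diffop wder A phi) (diffop (@derive1 K K) A phi).
Proof.
apply: (@eq_aev_sum_mul _ _ _ m n _ (fun k => coefmx k A)
  (fun k z => \col_i iter k wder (component phi i) z)
  (fun k z => \col_i iter k (@derive1 K K) (component phi i) z)) => k _.
apply: eq_aev_col => i; rewrite colE.
rewrite (_ : component _ _ = iter k wder (component phi i)); last first.
  by apply/funext => z; rewrite /component mxE.
exact: smooth_iter_wderive.
Qed.

Lemma smooth_LR : LR a b M R Rb smooth_ext.
Proof.
have aJ : a \in `[a, b] by rewrite in_itv/= lexx ltW.
have bJ : b \in `[a, b] by rewrite in_itv/= lexx ltW.
split; first split.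
- move=> i; have := continuous_in_L2 (@diffop_smooth_continuous _ R (lshift n i)).
  by rewrite (_ : component (ext_x _) i = component (diffop (@derive1 K K) R phi) (lshift n i))//;
     apply/funext => z; rewrite /component mxE.
- move=> i; have := continuous_in_L2 (@diffop_smooth_continuous _ R (rshift n i)).
  by rewrite (_ : component (ext_e _) i = component (diffop (@derive1 K K) R phi) (rshift n i))//;
     apply/funext => z; rewrite /component mxE.
exists phi; split.
- by move=> i; exact: smooth_sobolev.
- apply: (@filterS _ _ (@ae_filter K) _ _ _ (diffop_smooth_ae R)) => z e zJ.
  by rewrite vsubmxK e.
- rewrite vsubmxK.
  exact/(is_tracevE hab _ aJ (@diffop_smooth_continuous _ Rb) (diffop_smooth_ae Rb)).
- rewrite vsubmxK.
  exact/(is_tracevE hab _ bJ (@diffop_smooth_continuous _ Rb) (diffop_smooth_ae Rb)).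
Qed.

End Smooth.
End Green.

(** * The orthogonal complement of LR is contained in LR *)

Section Coisotropic.
Variables (K : realType) (a b : K).
Hypothesis hab : a < b.
Local Notation mu := (@lebesgue_measure K).
Local Notation J := `[a, b]%classic.
Local Notation wder := (wderive a b).
Variables (n p M : nat).
Variables (R : 'M[{poly K}]_(n + n, n)) (Rb : 'M[{poly K}]_(p + p, n)).
Hypothesis RM : (mxsize R <= M.+1)%N.
Hypothesis RbM : (mxsize Rb <= M)%N.
Hypothesis RRb : theta_form R = zeta_plus_eta K *: theta_form Rb.
Hypothesis Rbfree : row_free (\mxrow_(k < mxsize Rb) coefmx k Rb).

Lemma near0_derive1n (f : K -> K) (k : nat) (z : K) : (\forall x \near z, f x = 0) ->
  derive1n k f z = 0.
Proof.
elim: k z => [|k IH] z fz; first exact: nbhs_singleton fz.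
rewrite derive1nS derive1E -(@derive_cst K K^o K^o 0 z 1); apply: near_eq_derive.
move: fz => /near_join; apply: filterS => x fx.
exact: IH.
Qed.

Lemma test_smooth_derive1n_bnd (f : K -> K) k : test_smooth a b f ->
  derive1n k f a = 0 /\ derive1n k f b = 0.
Proof.
case=> _ [c [d [ac db f0]]]; split; apply: near0_derive1n; near=> x.
- have xc : x < c by near: x; exact: lt_nbhsl.
  by apply/eqP; apply: contraTT xc => /f0/andP[cx _]; rewrite -leNgt.
- have dx : d < x by near: x; exact: lt_nbhsr.
  by apply/eqP; apply: contraTT dx => /f0/andP[_ xd]; rewrite -leNgt.
Unshelve. all: by end_near. Qed.

Lemma test_smooth_diffop_bnd (phi : K -> 'cV[K]_n) m (A : 'M[{poly K}]_(m, n)) :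
  (forall i, test_smooth a b (component phi i)) ->
  diffop (@derive1 K K) A phi a = 0 /\ diffop (@derive1 K K) A phi b = 0.
Proof.
move=> tphi; rewrite /diffop; split; apply: big1 => k _.
- rewrite (_ : (\col_i _) = 0) ?mulmx0//; apply/matrixP => i j; rewrite !mxE.
  by have [] := test_smooth_derive1n_bnd k (tphi i).
- rewrite (_ : (\col_i _) = 0) ?mulmx0//; apply/matrixP => i j; rewrite !mxE.
  by have [] := test_smooth_derive1n_bnd k (tphi i).
Qed.

Lemma orthogonal_distr_ker c : orthogonal_complement a b (LR a b M R Rb) c ->
  distr_ker a b (formal_adjoint R *m Theta _ n) (fun z => col_mx (ext_x c z) (ext_e c z)).
Proof.
move=> [Lc orth] phi tphi.
have dphi i k z : derivable (derive1n k (component phi i)) z 1 by case: (tphi i).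
have := orth _ (smooth_LR hab M R Rb dphi).
rewrite alternate_productE /= !vsubmxK.
have [-> ->] := test_smooth_diffop_bnd Rb tphi; rewrite !dot0l !subr0 => <-.
apply: eq_Rintegral => z _; rewrite formal_adjoint_Theta diffop_Theta_mul.
by rewrite [LHS]dot_mulmxr trmxK dotC ?vsubmxK.
Qed.

Lemma trace_surjective (t : 'cV[K]_(p + p)) (s : 'cV[K]_(p + p)) :
  exists2 phi : K -> 'cV[K]_n,
    forall i k z, derivable (derive1n k (component phi i)) z 1 &
    diffop (@derive1 K K) Rb phi a = t /\ diffop (@derive1 K K) Rb phi b = s.
Proof.
have [v vt] := row_free_mxrow_surj t Rbfree.
have [w ws] := row_free_mxrow_surj s Rbfree.
(* Extends the finite jets to sequences, as interpolation expects; the default 0 lies beyond the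
   order of [Rb] and is never read. *)
pose jet_of (u : 'I_(mxsize Rb) -> 'cV[K]_n) i k :=
  if insub k is Some k' then u k' i 0 else 0.
have anb : a != b by rewrite lt_eqF.
have /choice[q qP] : forall i, exists q : {poly K}, forall k, (k < mxsize Rb)%N ->
    q^`(k).[a] = jet_of v i k /\ q^`(k).[b] = jet_of w i k.
  by move=> i; exact: hermite_interpolation.
pose phi (z : K) : 'cV[K]_n := \col_i (q i).[z].
have phiE i : component phi i = horner (q i).
  by apply/funext => z; rewrite /component mxE.
exists phi; first by move=> i k z; rewrite phiE; exact: derivable_derive1n_horner.
rewrite /diffop -vt -ws; split; apply: eq_bigr => k _; congr (_ *m _).
- apply/matrixP => i j; rewrite (ord1 j) mxE -[iter _ _ _]/(derive1n k _) phiE derive1n_horner.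
  by have [-> _] := qP i k (ltn_ord k); rewrite /jet_of valK.
- apply/matrixP => i j; rewrite (ord1 j) mxE -[iter _ _ _]/(derive1n k _) phiE derive1n_horner.
  by have [_ ->] := qP i k (ltn_ord k); rewrite /jet_of valK.
Qed.

Lemma LR_coisotropic : maximal a b M R ->
  orthogonal_complement a b (LR a b M R Rb) `<=` LR a b M R Rb.
Proof.
move=> maxR c orthc; have [Lc orth] := orthc.
have Lw : in_L2v a b (fun z => col_mx (ext_x c z) (ext_e c z)).
  by case: Lc => Lx Le; exact: in_L2v_col.
have [xi sxi wxi] := (maxR _ Lw).2 (orthogonal_distr_ker orthc).
have [U jU] := sobolev_jet hab sxi.
pose da := jet_trace M Rb U a - col_mx (ext_chi c).1 (ext_eps c).1.
pose db := jet_trace M Rb U b - col_mx (ext_chi c).2 (ext_eps c).2.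
(* [da] and [db] measure how far the boundary components of c are from the traces of xi.
   Orthogonality of c to [smooth_ext phi] is rewritten by the Green identity with (x, e) = R xi;
   only the defects paired with the traces of [phi] remain. *)
have pairing0 (t s : 'cV[K]_(p + p)) :
    dot s (Theta K p *m db) - dot t (Theta K p *m da) = 0.
  have [phi dphi [phia phib]] := trace_surjective t s.
  have Lphi := smooth_LR hab M R Rb dphi.
  have := orth _ Lphi.
  (* Membership yields some generator [xi'], not necessarily [phi]; its jet values are identified
     with the traces of [phi] through [ta'] and [tb']. *)
  move: (Lphi) => /(LR_jet hab R RbM)[L' [xi' [U' [sxi' jU' w' ta' tb']]]].
  rewrite (alternate_product_green hab RM RbM RRb L' Lc sxi' sxi jU' jU w' wxi).
  rewrite -ta' -tb' /= !vsubmxK phia phib => <-.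
  by rewrite !mulmxBr !dotBr; ring.
apply/(LR_jet hab R RbM); split=> //; exists xi, U; split=> //.
(* A zero trace at b isolates the defect at a, which vanishes because Theta is nondegenerate; the
   other endpoint is treated alike. *)
- apply/esym/eqP; rewrite -subr_eq0; apply/eqP; apply: dot_Theta_eq0 => t.
  by have := pairing0 t 0; rewrite dot0l sub0r => /eqP; rewrite oppr_eq0 => /eqP.
- apply/esym/eqP; rewrite -subr_eq0; apply/eqP; apply: dot_Theta_eq0 => t.
  by have := pairing0 0 t; rewrite dot0l subr0.
Qed.

End Coisotropic.

Theorem proposition23 (K : realType) (a b : K) (hab : a < b)
    (n M p : nat) (hn : (0 < n)%N)
    (R : 'M[{poly K}]_(n + n, n)) (hM : mxsize R = M.+1)
    (hR : maximally_reciprocal a b M R)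
    (Rb : 'M[{poly K}]_(p + p, n)) (hRb : boundary_polynomial_matrix R Rb) :
  Lagrangian a b (LR a b M R Rb).
Proof.
have [Rbfree [Psi RPsi PsiE]] := hRb; rewrite {}PsiE in RPsi.
have RM : (mxsize R <= M.+1)%N by rewrite hM.
(* [Rb] has order below M, so [Rb xi] has traces for every xi in H^M. *)
have RbM : (mxsize Rb <= M)%N := mxsize_boundary RPsi hM Rbfree.
have [_ maxR] := hR.
apply/seteqP; split; last exact: (LR_coisotropic hab RM RbM RPsi Rbfree maxR).
move=> c Lc; split; first by case: Lc.
by move=> c' Lc'; exact: (LR_isotropic hab RM RbM RPsi Lc' Lc).
Qed.
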